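(* Let $F$ be a free group of finite rank $n$ with free basis $X$, let $H$ be a subgroup of $F$ and let $\mathcal T$ be a Schreier transversal for $H$ in $F$, regarded as a tree. Let $\mathcal T_i$ ($i=1,2,\ldots$) be induced finite subgraphs of $\mathcal T$, all of whose connected components $\mathcal T_{i,j}$ are balls of $\mathcal T$, such that $\mathcal T=\liminf\mathcal T_i$. Then $$\operatorname{rank}(H)=\lim_{i\to\infty}\left(\alpha(\mathcal T_i)-\frac12\delta(\mathcal T_i)+(n-1)|V(\mathcal T_i)|-\frac{2n-1}{2}|V(\partial\mathcal T_i)|\right)$$ $$=\lim_{i\to\infty}\left(\alpha(\mathcal T_i)-\frac12\delta(\mathcal T_i)+(n-1)|V(\dot{\mathcal T}_i)|-\frac12|V(\partial\mathcal T_i)|\right).$$ In particular, $$\operatorname{rank}(H)=1+\lim_{i\to\infty}\left((n-1)\Gamma_{\mathcal T}(i)-\frac12\gamma_{\mathcal T}(i+1)\right)=1+\lim_{i\to\infty}\left((n-1)\Gamma_{F/H}(i)-\frac12\gamma_{F/H}(i+1)\right).$$ (All these quantities are $\infty$ when $H$ is not finitely generated.)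
   Context: The cosets graph $\mathcal G$ of $H$ (with respect to $X$) has as vertices the right cosets $Hg$, $g\in F$; for each coset $Hg$ and each $x\in X$ there is one (two-way) edge joining $Hg$ to $Hgx$, labeled $x$ in the direction from $Hg$ to $Hgx$ and $x^{-1}$ in the opposite direction (loops and multiple edges are allowed). A Schreier transversal for $H$ in $F$ is a set $\mathcal T$ of representatives of the right cosets of $H$, written as reduced words in $X\cup X^{-1}$, containing $1$ (representing $H$) and such that every initial segment of an element of $\mathcal T$ is in $\mathcal T$. Equivalently, it is a spanning tree of $\mathcal G$ rooted at the vertex $H$, each vertex being labeled by the word read along the tree path from the root to it; the same letter $\mathcal T$ denotes the tree and the set of its vertex labels. $\mathcal T$ is minimal if moreover every coset is represented by an element of minimal length in that coset. $V(\cdot)$ and $E(\cdot)$ denote vertex and edge sets. $\mathcal T=\liminf\mathcal T_i$ means $V(\mathcal T)=\bigcup_{i\ge1}\bigcap_{j\ge i}V(\mathcal T_j)$ and $E(\mathcal T)=\bigcup_{i\ge1}\bigcap_{j\ge i}E(\mathcal T_j)$. An induced subgraph of $\mathcal T$ contains every edge of $\mathcal T$ joining two of its vertices. A ball of $\mathcal T$ is the induced subgraph on all vertices of $\mathcal T$ at distance (in $\mathcal T$) at most some fixed $k\ge0$ from some fixed vertex. $\alpha(\mathcal T_i)$ is the number of connected components of $\mathcal T_i$. If $|V(\mathcal T)|>1$, $\delta(\mathcal T_i)$ is the number of connected components of $\mathcal T_i$ consisting of a single vertex; if $|V(\mathcal T)|=1$, $\delta(\mathcal T_i)=0$. The boundary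 is $\partial\mathcal T_i=\mathcal T_i\cap\langle\mathcal T-\mathcal T_i\rangle$, where $\mathcal T-\mathcal T_i$ is the collection of vertices and edges of $\mathcal T$ not in $\mathcal T_i$ and $\langle\cdot\rangle$ is the smallest subgraph containing the collection; thus $V(\partial\mathcal T_i)$ is the set of vertices of $\mathcal T_i$ adjacent in $\mathcal T$ to a vertex not in $\mathcal T_i$. The interior is $\dot{\mathcal T}_i=\mathcal T_i-\partial\mathcal T_i$, so $V(\dot{\mathcal T}_i)=V(\mathcal T_i)\setminus V(\partial\mathcal T_i)$. With $l(v)$ the length of the reduced word $v$ over $X\cup X^{-1}$, $\gamma_{\mathcal T}(i)=|\{v\in\mathcal T: l(v)=i\}|$ and $\Gamma_{\mathcal T}(i)=|\{v\in\mathcal T: l(v)\le i\}|$. $\gamma_{F/H}$ and $\Gamma_{F/H}$ denote these functions for a minimal Schreier transversal of $H$ (they do not depend on which minimal one is chosen); $\Gamma_{F/H}$ is the cogrowth function of $H$. *)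

(* Defs.v *)
From mathcomp Require Import all_boot all_order all_algebra finmap.
From mathcomp Require Import all_classical all_reals all_analysis.

Set Implicit Arguments.
Unset Strict Implicit.
Unset Printing Implicit Defensive.

Import numFieldNormedType.Exports.
Local Open Scope classical_set_scope.

(* Only meaningful on finite sets: it is 0 on infinite ones. *)
Definition card_set (U : choiceType) (A : set U) : nat := #|` fset_set A|%fset.

(* A letter (i, e) is the i-th generator, inverted when e is true. *)
Definition word (I : eqType) := seq (I * bool).

Definition reduced (I : eqType) : pred (word I) := fun w =>
  sorted [rel a c : I * bool | c != (a.1, ~~ a.2)] w.

Section Groups.
Variable F : groupType.
Implicit Types (H : set F).

Definition word_val (I : eqType) (b : I -> F) (w : word I) : F :=
  (\prod_(a <- w) (if a.2 then (b a.1)^-1 else b a.1))%g.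

(* Every element of H is the value of exactly one reduced word in the family b,
   and all values of reduced words are in H. *)
Definition free_basis (I : eqType) (b : I -> F) H : Prop :=
  H = [set word_val b w | w in [set w | reduced w]] /\
  {in @reduced I &, injective (word_val b)}.

(* The cardinality (possibly +oo) of a free basis of H; the default value set0
   is irrelevant for the subgroups of a free group, which have free bases. *)
Definition group_rank (R : realType) H : \bar R :=
  counting (xget set0 [set B : set F | free_basis (fun x : B => val x) H]).

Definition finitely_generated H : Prop :=
  exists2 B : set F, finite_set B &
    H = smallest (fun K : set F => group_closed (mem K)) B.

Definition right_coset H (g : F) : set F := [set (h * g)%g | h in H].

Section Transversals.
Variables (n : nat) (X : 'I_n -> F) (H : set F).

Definition schreier_transversal (T : set (word 'I_n)) : Prop :=
  [/\ forall w, T w -> reduced w,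
      T [::],
      forall u v, T (u ++ v) -> T u
    & forall g : F, exists! w, T w /\ right_coset H g (word_val X w)].

Definition minimal_schreier_transversal (T : set (word 'I_n)) : Prop :=
  schreier_transversal T /\
  forall w u, T w -> reduced u -> right_coset H (word_val X w) (word_val X u) ->
    (size w <= size u)%N.

(* gamma_T and Gamma_T *)
Definition sphere_growth (T : set (word 'I_n)) (i : nat) : nat :=
  card_set [set w | T w /\ size w = i].

Definition ball_growth (T : set (word 'I_n)) (i : nat) : nat :=
  card_set [set w | T w /\ (size w <= i)%N].

(* gamma_{F/H} and Gamma_{F/H}; the default value set0 is irrelevant when X is
   a free basis and H a subgroup, as minimal transversals then exist. *)
Definition cosphere_growth : nat -> nat :=
  sphere_growth (xget set0 [set T | minimal_schreier_transversal T]).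

Definition cogrowth : nat -> nat :=
  ball_growth (xget set0 [set T | minimal_schreier_transversal T]).

End Transversals.
End Groups.

(* A collection of vertices and edges. An edge joining u and v is represented
   by the two pairs (u, v) and (v, u); this is adequate for subgraphs of a tree,
   which have no loops and no multiple edges. *)
Record collection (V : Type) := Collection {
  verts : set V;
  edges : set (V * V) }.

Section Graphs.
Variable V : choiceType.
Implicit Types (G K C : collection V) (A : set V).

Definition is_graph G : Prop :=
  forall u v, edges G (u, v) -> [/\ verts G u, verts G v & edges G (v, u)].

Definition subgraph K G : Prop :=
  [/\ is_graph K, verts K `<=` verts G & edges K `<=` edges G].

Definition induced_subgraph K G : Prop :=
  subgraph K G /\
  forall u v, verts K u -> verts K v -> edges G (u, v) -> edges K (u, v).

Definition induced_on G A : collection V :=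
  Collection (verts G `&` A) [set e | [/\ edges G e, A e.1 & A e.2]].

Definition walk G (u : V) (p : seq V) : bool :=
  path [rel x y | (x, y) \in edges G] u p.

Definition graph_ball G (c : V) (k : nat) : collection V :=
  induced_on G [set v | exists p, [/\ walk G c p, last c p = v & (size p <= k)%N]].

Definition component_of G (u : V) : set V :=
  [set v | exists2 p, walk G u p & last u p = v].

(* The connected components of G, given by their vertex sets. *)
Definition components G : set (set V) := [set component_of G u | u in verts G].

Definition graph_diff G K : collection V :=
  Collection (verts G `\` verts K) (edges G `\` edges K).

Definition graph_inter G K : collection V :=
  Collection (verts G `&` verts K) (edges G `&` edges K).

Definition graph_span C : collection V :=
  Collection
    (verts C `|` [set u | exists v, edges C (u, v) \/ edges C (v, u)])
    (edges C `|` [set e | edges C (e.2, e.1)]).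

Definition graph_boundary G K : collection V :=
  graph_inter K (graph_span (graph_diff G K)).

Definition graph_interior G K : collection V :=
  graph_diff K (graph_boundary G K).

Definition num_components K : nat := card_set (components K).

Definition num_trivial_components G K : nat :=
  if `[< exists u v, [/\ verts G u, verts G v & u != v] >] then
    card_set [set C | components K C /\ exists v, C = [set v]]
  else 0.

(* The sequence is indexed by i >= 1. *)
Definition graph_liminf (K : nat -> collection V) : collection V :=
  Collection
    (\bigcup_(i in [set i | 1 <= i]%N)
       \bigcap_(j in [set j | i <= j]%N) verts (K j))
    (\bigcup_(i in [set i | 1 <= i]%N)
       \bigcap_(j in [set j | i <= j]%N) edges (K j)).

End Graphs.

(* The spanning tree of the cosets graph given by the transversal T, each vertex
   being identified with its label: w represents the coset of its value, and
   appending the letter a to w follows the edge labelled a. *)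
Definition transversal_tree (n : nat) (T : set (word 'I_n)) : collection (word 'I_n) :=
  Collection T
    [set e | [/\ T e.1, T e.2
              & exists a, e.2 = rcons e.1 a \/ e.1 = rcons e.2 a]].

(* Main.v *)
Require Import Defs.
From mathcomp Require Import all_boot all_order all_algebra finmap.
From mathcomp Require Import all_classical all_reals all_analysis.
From mathcomp Require Import zify lra.

(* For v in T and a letter a, let step v a be the reduced
   form of the word v a. The pairs (v, a) with v in T and step v a not in T are
   the ends of the edges of the cosets graph lying outside the tree T, so there
   are twice as many of them as Schreier generators of H; the latter form a
   free basis of H, and the rank does not depend on the free basis since a free
   basis B gives 2^|B| homomorphisms from H to Z/2.

   Both expressions in the theorem are exactly half the number of such pairs
   with v in the interior of T_i. Indeed, counting the pairs (v, a) with v in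
   T_i according to the position of step v a,
     2n |V(T_i)| = #(outside T) + #(inside T_i) + #(in T but not in T_i),
   where #(inside T_i) = 2 (|V(T_i)| - alpha(T_i)) because T_i is a forest, and
   a boundary vertex, being a leaf of a ball or a trivial component, has at most
   one neighbour in T_i. As every vertex of T is eventually interior, the
   interior pairs exhaust all the pairs. *)

Set Implicit Arguments.
Unset Strict Implicit.
Unset Printing Implicit Defensive.

Import Order.TTheory GRing.Theory Num.Theory.
Import numFieldNormedType.Exports.
Local Open Scope classical_set_scope.

(** * Reduced words and the rank *)

Section Words.
Variable I : eqType.
Implicit Types (a c : I * bool) (u v w : word I).

Definition inv_letter a : I * bool := (a.1, ~~ a.2).

Definition inv_word w : word I := rev (map inv_letter w).

(** Left multiplication by a letter in the free group realised on reduced words: at most one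
    cancellation can occur, at the head. *)
Definition cons_reduced a w : word I :=
  if w is c :: w' then if c == inv_letter a then w' else a :: w else [:: a].

Definition reduce w : word I := foldr cons_reduced [::] w.

Lemma inv_letterK : involutive inv_letter.
Proof. by case=> i e; rewrite /inv_letter /= negbK. Qed.

Lemma reduced_behead a w : reduced (a :: w) -> reduced w.
Proof. by rewrite /reduced /=; case: w => //= c w /andP[]. Qed.

Lemma reduced_cons a c w :
  reduced (a :: c :: w) = (c != inv_letter a) && reduced (c :: w).
Proof. by []. Qed.

Lemma cons_reduced_reduced a w : reduced w -> reduced (cons_reduced a w).
Proof.
case: w => [|c w] // rw /=; case: ifPn => ca; first exact: reduced_behead rw.
by rewrite reduced_cons ca.
Qed.

Lemma reduce_reduced w : reduced (reduce w).
Proof. by elim: w => //= a w; exact: cons_reduced_reduced. Qed.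

Lemma reduced_reduce w : reduced w -> reduce w = w.
Proof.
elim: w => //= a w IH raw; rewrite IH; last exact: reduced_behead raw.
by case: w raw {IH} => //= c w /andP[/negPf->].
Qed.

(** If the first letter cancels against the head of [w], reducedness of [w] keeps the second one
    from cancelling against the next letter. *)
Lemma cons_reducedK a w :
  reduced w -> cons_reduced a (cons_reduced (inv_letter a) w) = w.
Proof.
case: w => [|c w] rw /=; first by rewrite eqxx.
rewrite inv_letterK; case: eqP rw => [->|_] rw /=; last by rewrite eqxx.
by case: w rw => [|d w] //; rewrite reduced_cons /= => /andP[/negPf->].
Qed.

Lemma reduce_cat u v : reduce (u ++ v) = foldr cons_reduced (reduce v) u.
Proof. exact: foldr_cat. Qed.

Lemma reduce_catr u v : reduce (u ++ reduce v) = reduce (u ++ v).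
Proof. by rewrite !reduce_cat (reduced_reduce (reduce_reduced v)). Qed.

Lemma reduced_rcons w a : reduced (rcons w a) =
  reduced w && (if w is c :: w' then a != inv_letter (last c w') else true).
Proof. by case: w => //= c w; rewrite /reduced /= rcons_path. Qed.

Lemma size_cons_reduced a w : (size (cons_reduced a w) <= (size w).+1)%N.
Proof. by case: w => //= c w; case: ifP => //= _; lia. Qed.

(** Every cancellation strictly shortens the word. This serves to show that shortest words in a
    coset are reduced. *)
Lemma reduced_size w : (size w <= size (reduce w))%N -> reduced w.
Proof.
elim: w => // a w IH; rewrite [reduce _]/= => le.
have rw : reduced w.
  by apply: IH; have := size_cons_reduced a (reduce w); move: le => /=; lia.
have := cons_reduced_reduced a rw; move: le; rewrite (reduced_reduce rw).
by case: w {rw IH} => //= c w; case: ifP => //= _; lia.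
Qed.

Lemma inv_word_cons a w : inv_word (a :: w) = rcons (inv_word w) (inv_letter a).
Proof. by rewrite /inv_word /= rev_cons. Qed.

Section Value.
Variables (F : groupType) (b : I -> F).

Definition letter_val a : F := if a.2 then (b a.1)^-1%g else b a.1.

Lemma word_val_nil : word_val b [::] = 1%g.
Proof. by rewrite /word_val big_nil. Qed.

Lemma word_val_cons a w : word_val b (a :: w) = (letter_val a * word_val b w)%g.
Proof. by rewrite /word_val big_cons. Qed.

Lemma word_val_cat u v : word_val b (u ++ v) = (word_val b u * word_val b v)%g.
Proof.
elim: u => [|a u IH] /=; first by rewrite word_val_nil mul1g.
by rewrite !word_val_cons IH mulgA.
Qed.

Lemma word_val1 a : word_val b [:: a] = letter_val a.
Proof. by rewrite word_val_cons word_val_nil mulg1. Qed.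

Lemma word_val_rcons w a : word_val b (rcons w a) = (word_val b w * letter_val a)%g.
Proof. by rewrite -cats1 word_val_cat word_val1. Qed.

Lemma letter_val_inv a : letter_val (inv_letter a) = (letter_val a)^-1%g.
Proof. by rewrite /letter_val /=; case: a.2 => //=; rewrite invgK. Qed.

Lemma word_val_inv w : word_val b (inv_word w) = (word_val b w)^-1%g.
Proof.
elim: w => [|a w IH]; first by rewrite word_val_nil invg1.
by rewrite inv_word_cons word_val_rcons word_val_cons invgM IH letter_val_inv.
Qed.

Lemma word_val_cons_reduced a w :
  word_val b (cons_reduced a w) = (letter_val a * word_val b w)%g.
Proof.
case: w => [|c w] /=; first by rewrite word_val_cons.
case: eqP => [->|_]; last by rewrite !word_val_cons.
by rewrite word_val_cons letter_val_inv mulVKg.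
Qed.

Lemma word_val_reduce w : word_val b (reduce w) = word_val b w.
Proof.
by elim: w => //= a w IH; rewrite word_val_cons_reduced word_val_cons IH.
Qed.

Lemma free_basis_val H w : free_basis b H -> H (word_val b w).
Proof.
by case=> -> _; exists (reduce w); [exact: reduce_reduced|exact: word_val_reduce].
Qed.

Lemma free_basis_reduce H u v : free_basis b H ->
  word_val b u = word_val b v -> reduce u = reduce v.
Proof.
case=> _ binj uv; apply: binj; rewrite ?word_val_reduce //;
  exact: reduce_reduced.
Qed.

(** The homomorphism to Z/2 sending generator [i] to [f i]; exponent signs disappear modulo 2. *)
Definition parity (f : I -> bool) w : bool :=
  foldr (fun a p => f a.1 (+) p) false w.

Lemma parity_cat f u v : parity f (u ++ v) = parity f u (+) parity f v.
Proof. by elim: u => //= a u ->; rewrite addbA. Qed.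

Lemma parity_reduce f w : parity f (reduce w) = parity f w.
Proof.
elim: w => //= a w <-; case: (reduce w) => [|c v] //=.
by case: eqP => [->|//] /=; rewrite addKb.
Qed.

(** Universal property of a free basis for the target Z/2: [parity] is invariant under reduction, so
    it depends only on the value of the word. *)
Lemma free_basis_parity H (f : I -> bool) : free_basis b H ->
  exists chi : F -> bool,
    (forall g h, H g -> H h -> chi (g * h)%g = chi g (+) chi h) /\
    forall i, chi (b i) = f i.
Proof.
move=> bH.
have chiP g : exists p, forall w, word_val b w = g -> p = parity f w.
  case: (pselect (exists w, word_val b w = g)) => [[w wg]|nw]; last first.
    (* Elements that are not values of words get an arbitrary image. *)
    by exists false => w wg; case: nw; exists w.
  exists (parity f w) => v vg; rewrite -parity_reduce -(parity_reduce f v).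
  by congr parity; apply: free_basis_reduce bH _; rewrite wg.
case: (choice chiP) => chi chiE; exists chi; split=> [g h|i].
  case: (bH) => -> _ [u _ <-] [v _ <-].
  rewrite -word_val_cat (chiE _ (u ++ v)) // parity_cat.
  by rewrite (chiE _ u) // (chiE _ v).
by rewrite (chiE _ [:: (i, false)]) ?word_val1 //= addbF.
Qed.

End Value.
End Words.

Lemma free_basis_hom_eq (F : groupType) (B H : set F) (chi psi : F -> bool) :
  free_basis (fun x : B => val x) H ->
  (forall g h, H g -> H h -> chi (g * h)%g = chi g (+) chi h) ->
  (forall g h, H g -> H h -> psi (g * h)%g = psi g (+) psi h) ->
  {in B, chi =1 psi} -> forall h, H h -> chi h = psi h.
Proof.
move=> BH chiM psiM eB h; case: (BH) => -> _ [w _ <-] {h}.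
have H1 : H 1%g by rewrite -(word_val_nil (fun x : B => val x)); apply: free_basis_val.
have hom1 (f : F -> bool) : (forall g h, H g -> H h -> f (g * h)%g = f g (+) f h) ->
    f 1%g = false.
  by move=> fM; move: (fM _ _ H1 H1); rewrite mulg1; case: (f _).
have HL a : H (letter_val (fun x : B => val x) a).
  by rewrite -word_val1; apply: free_basis_val.
have eL a : chi (letter_val (fun x : B => val x) a) =
    psi (letter_val (fun x : B => val x) a).
  case: a => x []; last by apply: eB; exact: valP.
  have := HL (x, true); have := HL (x, false); rewrite /letter_val /= => Hx Hx'.
  have homV (f : F -> bool) :
      (forall g h, H g -> H h -> f (g * h)%g = f g (+) f h) ->
      f (val x)^-1%g = f (val x).
    move=> fM; have := fM _ _ Hx Hx'; rewrite mulgV hom1 //.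
    by case: (f _); case: (f _).
  rewrite !homV //; apply: eB; exact: valP.
elim: w => [|a w IH]; first by rewrite word_val_nil !hom1.
have Hw : H (word_val (fun x : B => val x) w) by exact: free_basis_val.
by rewrite word_val_cons chiM // psiM // eL IH.
Qed.

(** Each of the 2^|s'| colourings of [s'] extends to a homomorphism from [H] to Z/2, and such a
    homomorphism is determined by its values on [B], hence on [s]. Since [s'] lists only a part of
    [B'], the bound also applies to an infinite [B']. *)
Lemma free_basis_size_le (F : groupType) (B B' H : set F) (s s' : seq F) :
  free_basis (fun x : B => val x) H -> free_basis (fun x : B' => val x) H ->
  (forall x, B x -> x \in s) -> uniq s' -> (forall x, x \in s' -> B' x) ->
  (size s' <= size s)%N.
Proof.
move=> BH BH' Bs us' sB'.
pose g (i : 'I_(size s')) := tnth (in_tuple s') i.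
have gB i : B' (g i) by apply: sB'; exact: mem_tnth.
have ginj : injective g by apply/tuple_uniqP.
have chiP (eps : {ffun 'I_(size s') -> bool}) : exists chi : F -> bool,
    (forall g h, H g -> H h -> chi (g * h)%g = chi g (+) chi h) /\
    forall i, chi (g i) = eps i.
  have [chi [chiM chiE]] := free_basis_parity
    (fun x : B' => if [pick i | g i == val x] is Some i then eps i else false) BH'.
  exists chi; split=> // i.
  have gi : g i \in B' by rewrite inE.
  rewrite -[g i]/(val (exist _ (g i) gi : B')) chiE /=.
  by case: pickP => [j /eqP/ginj -> //|/(_ i)]; rewrite eqxx.
case: (choice chiP) => chi chiE.
pose phi (eps : {ffun 'I_(size s') -> bool}) : {ffun 'I_(size s) -> bool} :=
  [ffun i => chi eps (tnth (in_tuple s) i)].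
have : injective phi.
  move=> eps eps' eq_phi; apply/ffunP => i.
  case: (chiE eps) => M <-; case: (chiE eps') => M' <-.
  apply: (free_basis_hom_eq BH M M').
    move=> x; rewrite inE => /Bs xs.
    have /tnthP[j ->] : x \in in_tuple s by [].
    by have /ffunP/(_ j) := eq_phi; rewrite !ffunE.
  have gi : g i \in B' by rewrite inE.
  have := free_basis_val [:: (exist _ (g i) gi : B', false)] BH'.
  by rewrite word_val1.
move/leq_card; rewrite !card_ffun card_bool !card_ord.
by rewrite leq_exp2l.
Qed.

Lemma free_basis_counting (R : realType) (F : groupType) (B B' H : set F) :
  free_basis (fun x : B => val x) H -> free_basis (fun x : B' => val x) H ->
  counting B = counting B' :> \bar R.
Proof.
have fin (C C' : set F) : free_basis (fun x : C => val x) H ->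
    free_basis (fun x : C' => val x) H -> finite_set C -> finite_set C' /\
    (size (fset_set C') <= size (fset_set C))%N.
  move=> CH C'H fC.
  have fC' : finite_set C'.
    (* An infinite [C'] would contain a finite set with more elements than [C]. *)
    apply: contrapT => /(infinite_set_fset (size (fset_set C)).+1)[D DC'].
    suff : (size D <= size (fset_set C))%N by lia.
    apply: free_basis_size_le CH C'H _ (fset_uniq _) _ => [x Cx|x xD].
      by rewrite in_fset_set // inE.
    exact: DC'.
  split=> //; apply: free_basis_size_le CH C'H _ (fset_uniq _) _ => x.
    by rewrite in_fset_set // inE.
  by rewrite in_fset_set // inE.
move=> BH B'H; rewrite /counting; case: asboolP => fB.
  have [fB' le] := fin _ _ BH B'H fB; have [_ ge] := fin _ _ B'H BH fB'.
  by case: asboolP => // _; congr (_%:R%:E); apply/eqP; rewrite eqn_leq le ge.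
by case: asboolP => // /(fin _ _ B'H BH)[].
Qed.

Lemma group_rank_free_basis (R : realType) (F : groupType) (B H : set F) :
  free_basis (fun x : B => val x) H -> group_rank R H = counting B.
Proof.
move=> BH; apply: free_basis_counting (BH).
apply: (@xgetPex _ set0 [set C : set F | free_basis (fun x : C => val x) H]).
by exists B.
Qed.

(** * Schreier generators *)

Section Steps.
Variable I : eqType.
Implicit Types (a c : I * bool) (u v w : word I).

(* Right multiplication by a letter in the free group of reduced words. *)
Definition step v a : word I :=
  if v is c :: v' then
    if last c v' == inv_letter a then belast c v' else rcons v a
  else [:: a].

Lemma step_rcons u c a :
  step (rcons u c) a = if c == inv_letter a then u else rcons (rcons u c) a.
Proof. by case: u => [|d u] //=; rewrite last_rcons belast_rcons. Qed.

Lemma step_reduced_rcons v a : reduced (rcons v a) -> step v a = rcons v a.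
Proof.
case/lastP: v => [|u c] // uca; rewrite step_rcons; case: eqP => // ca.
move: uca; rewrite reduced_rcons ca; case: u => [|d u] /=.
  by rewrite inv_letterK eqxx.
by rewrite last_rcons inv_letterK eqxx /= andbF.
Qed.

Lemma step_rcons_inv v a : step (rcons v a) (inv_letter a) = v.
Proof. by rewrite step_rcons inv_letterK eqxx. Qed.

Lemma stepK v a : reduced v -> step (step v a) (inv_letter a) = v.
Proof.
case/lastP: v => [|u c] ruc; first by rewrite (step_rcons_inv [::]).
rewrite step_rcons; case: eqP => [<-|_]; last exact: step_rcons_inv.
exact: step_reduced_rcons.
Qed.

Lemma step_neq v a : step v a <> v.
Proof.
case/lastP: v => [//|u c]; rewrite step_rcons; case: eqP => _;
  by move/(congr1 size); rewrite !size_rcons; lia.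
Qed.

Lemma word_val_step (F : groupType) (b : I -> F) v a :
  word_val b (step v a) = (word_val b v * letter_val b a)%g.
Proof.
case/lastP: v => [|u c].
  by rewrite /step word_val1 word_val_nil mul1g.
rewrite step_rcons word_val_rcons; case: eqP => [->|_].
  by rewrite letter_val_inv mulgVK.
by rewrite !word_val_rcons.
Qed.

Lemma inv_wordK : involutive (@inv_word I).
Proof.
move=> w; rewrite /inv_word map_rev revK -map_comp.
by rewrite (eq_map (@inv_letterK I)) map_id.
Qed.

Lemma inv_word_cat u v : inv_word (u ++ v) = inv_word v ++ inv_word u.
Proof. by rewrite /inv_word map_cat rev_cat. Qed.

Lemma reduce_cancel w u : reduce (w ++ inv_word w ++ u) = reduce u.
Proof.
elim: w u => //= a w IH u.
by rewrite inv_word_cons cat_rcons IH /= cons_reducedK // reduce_reduced.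
Qed.

End Steps.

(** * Reidemeister-Schreier rewriting and the Schreier basis *)

Section Schreier.
Variables (F : groupType) (n : nat) (X : 'I_n -> F).
Hypothesis freeX : free_basis X setT.
Variable H : set F.
Hypothesis subgroupH : group_closed (mem H).
Variable T : set (word 'I_n).
Hypothesis transT : schreier_transversal X H T.
Implicit Types (a : 'I_n * bool) (u v w : word 'I_n) (e : word 'I_n * 'I_n * bool).

Let valX := word_val X.

Lemma subgroup1 : H 1%g.
Proof. by case: subgroupH => + _; rewrite inE. Qed.

Lemma subgroupF g h : H g -> H h -> H (g * h^-1)%g.
Proof. by case: subgroupH => _ HF Hg Hh; rewrite -inE; apply: HF; rewrite inE. Qed.

Lemma subgroupV g : H g -> H g^-1%g.
Proof. by move/(subgroupF subgroup1); rewrite mul1g. Qed.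

Lemma subgroupM g h : H g -> H h -> H (g * h)%g.
Proof. by move=> Hg /subgroupV/(subgroupF Hg); rewrite invgK. Qed.

Lemma in_right_coset g h : right_coset H g h <-> H (h * g^-1)%g.
Proof.
split=> [[k Hk <-]|Hhg]; first by rewrite mulgK.
by exists (h * g^-1)%g => //; rewrite mulgVK.
Qed.

Lemma transversal_reduced w : T w -> reduced w.
Proof. by case: transT => + _ _ _; apply. Qed.

Lemma transversal_nil : T [::]. Proof. by case: transT. Qed.

Lemma transversal_rcons w a : T (rcons w a) -> T w.
Proof. by rewrite -cats1; case: transT => _ _ + _; apply. Qed.

Lemma transversal_step_rcons w a : T (rcons w a) -> step w a = rcons w a.
Proof. by move/transversal_reduced/step_reduced_rcons. Qed.

Lemma representative_exists g : exists w, T w /\ right_coset H g (valX w).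
Proof. by case: transT => _ _ _ /(_ g)[w [? _]]; exists w. Qed.

Definition representative g := sval (cid (representative_exists g)).

Lemma representative_in g : T (representative g).
Proof. by rewrite /representative; case: cid => w []. Qed.

Lemma representative_eq g w : T w -> H (valX w * g^-1)%g -> representative g = w.
Proof.
move=> Tw /in_right_coset gw; rewrite /representative; case: cid => v /= [Tv gv].
by case: transT => _ _ _ /(_ g)[z [_ zP]]; rewrite -(zP v) ?(zP w).
Qed.

Lemma representative_val g : H (g * (valX (representative g))^-1)%g.
Proof.
rewrite /representative; case: cid => v /= [Tv /in_right_coset/subgroupV].
by rewrite invgF.
Qed.

Lemma representative_coset g g' : H (g * g'^-1)%g -> representative g = representative g'.
Proof.
move=> gg'; apply: representative_eq; first exact: representative_in.
have := representative_val g'; move: (representative g') => w.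
move=> /(subgroupM gg'); rewrite mulgA mulgVK => /subgroupV.
by rewrite invgF.
Qed.

(** One step in the cosets graph, each coset being named by its representative in [T]. Unlike
    [step], it never leaves [T]. *)
Definition move v a := representative (valX v * letter_val X a)%g.

Lemma move_in v a : T (move v a). Proof. exact: representative_in. Qed.

Lemma move_step v a : T (step v a) -> move v a = step v a.
Proof.
move=> Tva; apply: representative_eq => //.
by rewrite /valX word_val_step mulgV; exact: subgroup1.
Qed.

Lemma moveK v a : T v -> move (move v a) (inv_letter a) = v.
Proof.
move=> Tv; apply: representative_eq => //; rewrite letter_val_inv.
by rewrite invgM invgK mulgA; exact: representative_val.
Qed.

(** An edge outside the tree is also outside it when seen from its far end: otherwise stepping back
    along it would give [v], and [step v a] would be [move v a], which is in [T]. *)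
Lemma move_nontree v a : T v -> ~ T (step v a) ->
  ~ T (step (move v a) (inv_letter a)).
Proof.
move=> Tv nT Tm; apply: nT.
have := move_step Tm; rewrite moveK // => /(congr1 (fun w => step w a)) ->.
have := stepK (inv_letter a) (transversal_reduced (move_in v a)).
by rewrite inv_letterK => ->; exact: move_in.
Qed.

(** Each edge outside the tree is named once, by its origin when it is read along a positive
    generator. *)
Definition nontree : set (word 'I_n * 'I_n) :=
  [set d | T d.1 /\ ~ T (step d.1 (d.2, false))].

(** The Schreier generator of the edge: out along the tree, across the edge, back along the tree. *)
Definition generator (d : word 'I_n * 'I_n) : F :=
  (valX d.1 * X d.2 * (valX (move d.1 (d.2, false)))^-1)%g.

Lemma generator_in d : H (generator d).
Proof. exact: representative_val. Qed.

(** The contribution of one letter to the rewriting: nothing along the tree, and the inverse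
    generator when an edge is crossed against its orientation, its origin then being the arrival
    vertex. *)
Definition crossing v a : word (word 'I_n * 'I_n)%type :=
  if step v a \in T then [::]
  else if a.2 then [:: ((move v a, a.1), true)] else [:: ((v, a.1), false)].

Lemma word_val_crossing v a : T v -> word_val generator (crossing v a) =
  (valX v * letter_val X a * (valX (move v a))^-1)%g.
Proof.
move=> Tv; rewrite /crossing; case: ifPn => [|_]; first rewrite inE => Tva.
  by rewrite move_step // /valX word_val_step mulgV word_val_nil.
case: a => i [] /=; rewrite word_val1 //.
rewrite {1}/letter_val /= /generator /=.
by rewrite (@moveK v (i, true)) // invgF /letter_val invgM /= mulgA.
Qed.

Lemma crossing_inv v a : T v ->
  crossing (move v a) (inv_letter a) = inv_word (crossing v a).
Proof.
move=> Tv; rewrite /crossing; case: ifPn; rewrite ?inE ?notin_setE.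
  move=> Tm; case: ifPn => //; rewrite notin_setE => /(move_nontree Tv) //.
move=> Tm; case: (boolP (step v a \in T)); rewrite ?inE ?notin_setE => Ts.
  exfalso; apply: Tm; rewrite move_step // stepK //; exact: transversal_reduced.
by case: a Tm Ts => i [] Tm Ts //=; rewrite moveK.
Qed.

Lemma crossing_nontree v a e : T v -> e \in crossing v a -> nontree e.1.
Proof.
move=> Tv; rewrite /crossing; case: ifPn => //; rewrite notin_setE => Ts.
case: a Ts => i [] Ts; rewrite inE => /eqP -> //; split; first exact: move_in.
exact: (move_nontree Tv Ts).
Qed.

(* Reidemeister-Schreier rewriting: the edges outside the tree met when reading
   u from the coset of v. *)
Fixpoint crossings v u : word (word 'I_n * 'I_n)%type :=
  if u is a :: u' then crossing v a ++ crossings (move v a) u' else [::].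

Definition moves v u := foldl move v u.

Lemma crossings_cat v u w :
  crossings v (u ++ w) = crossings v u ++ crossings (moves v u) w.
Proof. by elim: u v => //= a u IH v; rewrite IH catA. Qed.

Lemma moves_cat v u w : moves v (u ++ w) = moves (moves v u) w.
Proof. exact: foldl_cat. Qed.

Lemma moves_representative v u : T v -> moves v u = representative (valX v * valX u)%g.
Proof.
elim: u v => [|a u IH] v Tv /=.
  apply/esym/representative_eq => //; rewrite /valX word_val_nil mulg1 mulgV.
  exact: subgroup1.
rewrite IH; last exact: move_in.
rewrite /valX word_val_cons mulgA; apply: representative_coset.
rewrite invgM mulgA mulgK; have := representative_val (valX v * letter_val X a)%g.
by move/subgroupV; rewrite invgF.
Qed.

(** The product telescopes: the representatives of the intermediate cosets cancel. *)
Lemma word_val_crossings v u : T v -> word_val generator (crossings v u) =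
  (valX v * valX u * (valX (moves v u))^-1)%g.
Proof.
elim: u v => [|a u IH] v Tv /=.
  by rewrite /valX !word_val_nil mulg1 mulgV.
rewrite word_val_cat word_val_crossing // IH; last exact: move_in.
by rewrite /valX word_val_cons !mulgA mulgVK.
Qed.

Lemma crossings_nontree v u e : T v -> e \in crossings v u -> nontree e.1.
Proof.
elim: u v => //= a u IH v Tv; rewrite mem_cat => /orP[]; first exact: crossing_nontree.
by apply: IH; exact: move_in.
Qed.

(** A cancelling pair of letters crosses an edge back and forth, so it contributes a word followed
    by its inverse. Hence rewriting is compatible with free reduction. *)
Lemma crossings_cons_reduced v a u : T v ->
  reduce (crossings v (cons_reduced a u)) = reduce (crossings v (a :: u)).
Proof.
case: u => [|c u] Tv //=; case: eqP => [->|//] /=.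
by rewrite crossing_inv // reduce_cancel moveK.
Qed.

Lemma crossings_reduce v u : T v ->
  reduce (crossings v (reduce u)) = reduce (crossings v u).
Proof.
elim: u v => //= a u IH v Tv; rewrite crossings_cons_reduced //=.
by rewrite -reduce_catr IH ?reduce_catr //; exact: move_in.
Qed.

(** All prefixes of [w] are in [T], so reading [w] from the root stays in the tree. *)
Lemma tree_path w : T w -> crossings [::] w = [::] /\ moves [::] w = w.
Proof.
elim/last_ind: w => //= w a IH Twa; have Tw := transversal_rcons Twa.
have sw := transversal_step_rcons Twa.
have [cw mw] := IH Tw; rewrite -cats1 crossings_cat moves_cat cw mw /= /crossing.
by rewrite sw ifT ?inE // move_step sw // cats1.
Qed.

Lemma tree_path_inv w : T w ->
  crossings w (inv_word w) = [::] /\ moves w (inv_word w) = [::].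
Proof.
elim/last_ind: w => //= w a IH Twa; have Tw := transversal_rcons Twa.
have [cw mw] := IH Tw; rewrite -cats1 inv_word_cat cats1 /= /crossing.
by rewrite step_rcons_inv ifT ?inE // move_step step_rcons_inv ?cw.
Qed.

(** A word over [X] spelling the Schreier generator [e.1], or its inverse if [e.2] holds. *)
Definition loop e : word 'I_n :=
  let p := e.1.1 ++ (e.1.2, false) :: inv_word (move e.1.1 (e.1.2, false)) in
  if e.2 then inv_word p else p.

Lemma crossings_loop e : nontree e.1 ->
  crossings [::] (loop e) = [:: e] /\ moves [::] (loop e) = [::].
Proof.
case: e => [[w i] s] [/= Tw Ns]; rewrite /loop /=.
have Tm : T (move w (i, false)) by exact: move_in.
have [cw mw] := tree_path Tw; have [cm mm] := tree_path_inv Tm.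
have cwi : crossing w (i, false) = [:: ((w, i), false)].
  by rewrite /crossing ifF //; apply/negP; rewrite inE.
case: s; last first.
  by rewrite crossings_cat moves_cat cw mw /= cm mm cwi.
have [cw' mw'] := tree_path_inv Tw; have [cm' mm'] := tree_path Tm.
rewrite inv_word_cat inv_word_cons inv_wordK cat_rcons crossings_cat moves_cat cm' mm' /=.
by rewrite moveK // mw' cw' crossing_inv // cwi.
Qed.

Lemma word_val_loop e : valX (loop e) = letter_val generator e.
Proof.
have E w i : valX (w ++ (i, false) :: inv_word (move w (i, false))) = generator (w, i).
  by rewrite /valX word_val_cat word_val_cons word_val_inv mulgA.
case: e => [[w i] []]; rewrite /loop /letter_val [LHS]/= [RHS]/= -E //.
exact: word_val_inv.
Qed.

Lemma crossings_loops (W : word (word 'I_n * 'I_n)%type) :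
  (forall e, e \in W -> nontree e.1) ->
  crossings [::] (flatten (map loop W)) = W /\
  valX (flatten (map loop W)) = word_val generator W.
Proof.
elim: W => [|e W IH] NW /=; first by rewrite /valX !word_val_nil.
have [cW vW] := IH (fun f fW => NW f (mem_behead (s := _ :: W) fW)).
have [ce me] := crossings_loop (NW e (mem_head _ _)).
rewrite crossings_cat ce me cW; split=> //.
by rewrite /valX word_val_cat -!/valX vW word_val_cons -word_val_loop.
Qed.

(** Substituting loops for generators and rewriting gives back [W]. Equal values in [F] give loop
    words with the same reduced form, as [X] is a free basis, and rewriting respects reduction. *)
Lemma generator_unique (W W' : word (word 'I_n * 'I_n)%type) :
  (forall e, e \in W -> nontree e.1) -> (forall e, e \in W' -> nontree e.1) ->
  reduced W -> reduced W' ->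
  word_val generator W = word_val generator W' -> W = W'.
Proof.
move=> NW NW' rW rW' eW.
have [cW vW] := crossings_loops NW; have [cW' vW'] := crossings_loops NW'.
rewrite -(reduced_reduce rW) -(reduced_reduce rW') -cW -cW'.
rewrite -(crossings_reduce _ transversal_nil).
rewrite -[in RHS](crossings_reduce _ transversal_nil).
congr (reduce (crossings _ _)); apply: free_basis_reduce freeX _.
by rewrite -/valX vW vW'.
Qed.

Lemma generator_inj : {in nontree &, injective generator}.
Proof.
move=> e e'; rewrite !inE => Ne Ne' eq_e.
suff [] : [:: (e, false)] = [:: (e', false)] by [].
apply: generator_unique; rewrite ?word_val1 // => f; by rewrite inE => /eqP ->.
Qed.

Definition schreier_generators : set F := generator @` nontree.

Lemma schreier_free_basis : free_basis (fun x : schreier_generators => val x) H.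
Proof.
split.
  apply/seteqP; split=> [h Hh|_ [W _ <-]]; last first.
    elim: W => [|[x s] W IH]; first by rewrite word_val_nil; exact: subgroup1.
    rewrite word_val_cons; apply: subgroupM => //.
    have Hx : H (val x) by case: x => x /=; rewrite inE => -[e _ <-]; exact: generator_in.
    by case: s; rewrite /letter_val //; exact: subgroupV.
  have [u _ uh] : [set word_val X w | w in [set w | reduced w]] h.
    by case: freeX => <-.
  (* As [h] is in [H], the walk spelled by [u] ends at the root again, and the telescoped product is
     [h] itself. *)
  have hE : word_val generator (crossings [::] u) = h.
    rewrite word_val_crossings; last exact: transversal_nil.
    rewrite moves_representative; last exact: transversal_nil.
    rewrite /valX word_val_nil mul1g uh (@representative_eq _ [::]).
    - by rewrite word_val_nil invg1 mulg1.
    - exact: transversal_nil.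
    - by rewrite /valX word_val_nil mul1g; exact: subgroupV.
  have : forall e, e \in crossings [::] u -> nontree e.1.
    by move=> e; apply: crossings_nontree; exact: transversal_nil.
  (* Passage from words over edges to words over the set of generators; [edge] below goes the other
     way. *)
  suff lift (W : word (word 'I_n * 'I_n)%type) : (forall e, e \in W -> nontree e.1) ->
      exists V : word schreier_generators,
        word_val (fun x : schreier_generators => val x) V = word_val generator W.
    move/lift => [V VE]; exists (reduce V); first exact: reduce_reduced.
    by rewrite word_val_reduce VE.
  elim: W => [|[e s] W IH] NW; first by exists [::]; rewrite !word_val_nil.
  have [V VE] := IH (fun f fW => NW f (mem_behead (s := _ :: W) fW)).
  have ge : generator e \in schreier_generators.
    by rewrite inE; exists e => //; exact: (NW (e, s) (mem_head _ _)).
  exists ((exist _ (generator e) ge : schreier_generators, s) :: V).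
  by rewrite !word_val_cons VE.
have /choice[edge edgeP] : forall x : schreier_generators, exists d,
    nontree d /\ generator d = val x.
  by case=> x /=; rewrite inE => -[e Ne <-]; exists e.
pose f (a : schreier_generators * bool) := (edge a.1, a.2).
have finj : injective f.
  move=> [x s] [y t] [exy ->]; congr pair; apply: val_inj.
  by rewrite -(edgeP x).2 -(edgeP y).2 exy.
have fval V : word_val (fun x : schreier_generators => val x) V =
    word_val generator (map f V).
  elim: V => [|[x s] V IH]; first by rewrite !word_val_nil.
  by rewrite /= !word_val_cons IH /letter_val /= (edgeP x).2.
have fred V : reduced V -> reduced (map f V).
  case: V => // a V; rewrite /reduced /= path_map; apply: sub_path => c d /=.
  apply: contraNneq; case: c d => x s [y t] [exy ->]; apply/eqP; congr pair.
  by apply: val_inj; rewrite /= -(edgeP x).2 -(edgeP y).2 exy.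
move=> V V' rV rV'; rewrite !fval => eV; apply: (inj_map finj).
apply: generator_unique eV; rewrite ?fred //.
- by move=> _ /mapP[a _ ->]; exact: (edgeP a.1).1.
- by move=> _ /mapP[a _ ->]; exact: (edgeP a.1).1.
Qed.

End Schreier.

(** * Cardinalities of exhausting sequences of sets *)

Lemma card_set_seq (U : choiceType) (A : set U) (s : seq U) :
  uniq s -> (forall x, A x <-> x \in s) -> card_set A = size s.
Proof.
move=> us As; have fA : finite_set A.
  by rewrite (_ : A = [set` s]) //; apply/seteqP; split=> x /As.
apply/eqP; rewrite -uniq_size_uniq ?fset_uniq // => x.
by rewrite in_fset_set //; apply/idP/idP; rewrite inE => /As.
Qed.

Section Limit.
Local Open Scope ring_scope.
Variables (R : realType) (U : choiceType).
Implicit Types A : set U.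

Lemma card_set_sub A (s : seq U) : finite_set A -> uniq s ->
  (forall x, x \in s -> A x) -> (size s <= card_set A)%N.
Proof.
move=> fA us sA; apply: uniq_leq_size => // x /sA Ax.
by rewrite in_fset_set // inE.
Qed.

Lemma near_all_mem (D : nat -> set U) (s : seq U) :
  (forall x, x \in s -> \forall i \near \oo, D i x) ->
  \forall i \near \oo, forall x, x \in s -> D i x.
Proof.
elim: s => [|x s IH] sD; first by near=> i.
have := IH (fun y ys => sD y (mem_behead (s := x :: s) ys)).
have := sD x (mem_head _ _).
by apply: filterS2 => i Dx Ds y; rewrite inE => /predU1P[->//|]; exact: Ds.
Unshelve. all: by end_near. Qed.

(** If [A] is finite, [D i] is eventually equal to it; if not, [D i] eventually contains any given
    finite part of [A], and these are arbitrarily large. *)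
Lemma cvg_card_counting A (D : nat -> set U) :
  (\forall i \near \oo, finite_set (D i) /\ D i `<=` A) ->
  (forall x, A x -> \forall i \near \oo, D i x) ->
  (card_set (D i))%:R%:E @[i --> \oo] --> (counting A : \bar R).
Proof.
move=> fD AD; rewrite /counting; case: asboolP => fA.
  apply: cvg_near_cst; have sA x : x \in fset_set A -> A x.
    by rewrite in_fset_set // inE.
  have := near_all_mem (fun x xA => AD x (sA x xA)).
  apply: filterS2 fD => i [_ DA] AiD; rewrite /card_set.
  suff -> : D i = A by [].
  apply/seteqP; split=> // x Ax.
  by apply: AiD; rewrite in_fset_set // inE.
apply/cvgeyPge => M.
have [B BA sB] := infinite_set_fset (Num.truncn M).+1 fA.
have := near_all_mem (fun x xB => AD x (BA x xB)).
apply: filterS2 fD => i [fDi _] DB.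
rewrite lee_fin; apply: (@le_trans _ _ ((Num.truncn M).+1%:R)).
  by apply/ltW/truncnS_gt.
rewrite ler_nat; apply: (leq_trans sB).
by apply: card_set_sub => //; exact: fset_uniq.
Qed.

End Limit.

Lemma counting_image (R : realType) (U V : choiceType) (A : set U) (f : U -> V) :
  {in A &, injective f} -> counting (f @` A) = counting A :> \bar R.
Proof.
move=> finj; have e := inj_card_eq finj; rewrite /counting.
case: asboolP => fA; case: asboolP => // fA'.
- by rewrite (fcard_eq fA fA' e).
- by case: fA'; rewrite -(eq_finite_set e).
- by case: fA; rewrite (eq_finite_set e).
Qed.

(** * The rank as half the number of ends of edges outside the tree *)

Section Ends.
Variables (F : groupType) (n : nat) (X : 'I_n -> F).
Hypothesis freeX : free_basis X setT.
Variable H : set F.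
Hypothesis subgroupH : group_closed (mem H).

Definition tree_ends (T : set (word 'I_n)) : set (word 'I_n * ('I_n * bool)) :=
  [set p | T p.1 /\ ~ T (step p.1 p.2)].

Section Transversal.
Variable T : set (word 'I_n).
Hypothesis transT : schreier_transversal X H T.

(** The two ends of an edge: its origin with the positive letter, and its far end with the inverse
    letter. *)
Let end_of (p : word 'I_n * 'I_n * bool) : word 'I_n * ('I_n * bool) :=
  if p.2 then (move transT p.1.1 (p.1.2, false), (p.1.2, true))
  else (p.1.1, (p.1.2, false)).

Lemma tree_endsE : tree_ends T = end_of @` (nontree T `*` [set: bool]).
Proof.
apply/seteqP; split=> [[v [i []]] [/= Tv Ns]|_ [[[w i] []] [[/= Tw Ns] _] <-]].
- exists (move transT v (i, true), i, true); rewrite /end_of /=; last first.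
    by rewrite (moveK subgroupH transT (i, true)).
  split=> //; split; first exact: move_in.
  exact: (move_nontree subgroupH Tv Ns).
- by exists (v, i, false).
- split=> /=; first exact: move_in.
  exact: (move_nontree subgroupH Tw Ns).
- by [].
Qed.

Lemma end_of_inj : {in nontree T `*` [set: bool] &, injective end_of}.
Proof.
move=> [[w i] s] [[w' i'] s']; rewrite !inE /end_of => -[[/= Tw _] _] [[/= Tw' _] _].
case: s s' => [] [] //= [e ei]; rewrite ei in e *; last by rewrite e.
congr (_, _, _).
by rewrite -(moveK subgroupH transT (i', false) Tw) e moveK.
Qed.

Lemma group_rank_ends (R : realType) :
  group_rank R H = ((2^-1)%R%:E * counting (tree_ends T))%E.
Proof.
rewrite (group_rank_free_basis _ (schreier_free_basis freeX subgroupH transT)).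
rewrite (counting_image _ (generator_inj freeX subgroupH (transT := transT))).
rewrite tree_endsE (counting_image _ end_of_inj) /counting.
have fb : finite_set [set: bool] by exact: finite_finset.
case: asboolP => fN.
  case: asboolP => [_|[]]; last exact: finite_setX.
  rewrite -[#|` fset_set (_ `*` _)|]/(card_set (nontree T `*` [set: bool])).
  rewrite (@card_set_seq _ _ [seq (d, b) | d <- fset_set (nontree T), b <- [:: true; false]]).
  - by rewrite size_allpairs -EFinM natrM mulrCA mulVf ?mulr1.
  - by apply: allpairs_uniq => // -[? ?] [? ?].
  - move=> [d b]; split=> [[Nd _]|/allpairsP[[d' b'] [/= + _ [-> _]]]]; last first.
      by rewrite in_fset_set // inE.
    by apply: allpairs_f; rewrite ?in_fset_set ?inE //; case: b {Nd}.
(* With infinitely many edges, a finite set of ends is excluded by projecting it onto the edges. *)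
case: asboolP => [fE|_]; last by rewrite gt0_muley // lte_fin invr_gt0.
case: fN; rewrite -(_ : fst @` (nontree T `*` [set: bool]) = nontree T).
  exact: finite_image.
apply/seteqP; split=> [_ [[d s] [? _] <-] //|d Nd].
by exists (d, true).
Qed.

End Transversal.
End Ends.

(** * Minimal transversals *)

Section MinimalTransversal.
Variable n : nat.
Implicit Types (u v w : word 'I_n).

Let base := #|{: 'I_n * bool}|.+1.
Let digit (a : 'I_n * bool) := (enum_rank a).+1.

(* With nonzero digits, comparing codes is the shortlex order on words. *)
Definition code w : nat := foldl (fun c a => c * base + digit a)%N 0%N w.

Lemma code_rcons w a : code (rcons w a) = (code w * base + digit a)%N.
Proof. by rewrite /code foldl_rcons. Qed.

Lemma digit_lt a : (digit a < base)%N. Proof. by rewrite ltnS; exact: ltn_ord. Qed.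

Lemma code_cat u v : code (u ++ v) = (code u * base ^ size v + code v)%N.
Proof.
elim/last_ind: v => [|v a IH]; first by rewrite cats0 expn0 muln1 addn0.
by rewrite -rcons_cat !code_rcons IH size_rcons expnSr; lia.
Qed.

Lemma code_lt w : (code w < base ^ size w)%N.
Proof.
elim/last_ind: w => [|w a IH] //; rewrite code_rcons size_rcons expnSr.
by have := digit_lt a; nia.
Qed.

(** The leading digit is nonzero. Together with [code_lt] this makes longer words have larger
    codes. *)
Lemma code_rcons_ge w a : (base ^ size w <= code (rcons w a))%N.
Proof.
elim/last_ind: w a => [|w b IH] a; rewrite code_rcons.
  by rewrite expn0 /digit; lia.
by rewrite size_rcons expnSr; have := IH b; nia.
Qed.

Lemma code_size u v : (code u <= code v)%N -> (size u <= size v)%N.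
Proof.
move=> uv; rewrite leqNgt; apply/negP; case/lastP: u uv => // u a uv.
rewrite size_rcons ltnS => vu; have := code_lt v; have := code_rcons_ge u a.
have : (base ^ size v <= base ^ size u)%N by rewrite leq_pexp2l.
lia.
Qed.

Lemma code_inj : injective code.
Proof.
elim/last_ind => [|u a IH] v; case/lastP: v => [|v b] //; rewrite ?code_rcons.
- by rewrite /digit addnS.
- by rewrite /digit addnS.
move=> e; have := congr1 (modn^~ base) e; have := congr1 (divn^~ base) e.
rewrite !divnMDl // !divn_small ?digit_lt // !addn0 !modnMDl !modn_small ?digit_lt //.
by move=> /IH -> [] /val_inj/enum_rank_inj ->.
Qed.

(** The shortlex-least words of the cosets form a minimal transversal. *)
Lemma minimal_transversal_exists (F : groupType) (X : 'I_n -> F) (H : set F) :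
  free_basis X setT -> group_closed (mem H) ->
  exists T, minimal_schreier_transversal X H T.
Proof.
move=> freeX subgroupH.
pose T := [set w | forall u, right_coset H (word_val X w) (word_val X u) ->
  (code w <= code u)%N].
have cosetV g h : right_coset H g h -> right_coset H h g.
  by move/in_right_coset/(subgroupV subgroupH); rewrite invgF => /in_right_coset.
have cosetM g h k : right_coset H g h -> right_coset H h k -> right_coset H g k.
  move=> /in_right_coset gh /in_right_coset hk; apply/in_right_coset.
  by have := subgroupM subgroupH hk gh; rewrite mulgA mulgVK.
have coset1 g : right_coset H g g.
  by apply/in_right_coset; rewrite mulgV; exact: subgroup1.
have redT w : T w -> reduced w.
  move=> Tw; have := Tw (reduce w); rewrite word_val_reduce => /(_ (coset1 _)).
  by move/code_size/reduced_size.
exists T; split; last by move=> w u Tw _ /Tw/code_size.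
split=> // [u v Tuv u' uu'|g].
  (* Closure under prefixes: replacing [u] by a smaller word of its coset would make [u ++ v]
     smaller within its own coset. *)
  have /Tuv : right_coset H (word_val X (u ++ v)) (word_val X (u' ++ v)).
    apply/in_right_coset; move/in_right_coset: uu'.
    by rewrite !word_val_cat invgM mulgA mulgK.
  rewrite !code_cat; have : (0 < base ^ size v)%N by rewrite expn_gt0.
  by rewrite leq_add2r => b0; rewrite leq_pmul2r.
have ex : exists c, `[< exists w, code w = c /\ right_coset H g (word_val X w) >].
  have [w _ wg] : [set word_val X w | w in [set w | reduced w]] g.
    by case: freeX => <-.
  by exists (code w); apply/asboolP; exists w; rewrite wg.
case: (ex_minnP ex) => c /asboolP[w [wc gw]] cmin.
have wP u : right_coset H g (word_val X u) -> (code w <= code u)%N.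
  by move=> gu; rewrite wc; apply: cmin; apply/asboolP; exists u.
exists w; split; first by split=> // u wu; apply/wP/(cosetM _ _ _ gw).
move=> v [Tv gv]; apply: code_inj; apply/eqP; rewrite eqn_leq wP //=.
by apply: Tv; exact: cosetM (cosetV _ _ gv) gw.
Qed.

End MinimalTransversal.

(** * Counting edges in a prefix tree *)

Lemma card_pred_sum (L : finType) (P : pred L) : #|P| = (\sum_a (P a : nat))%N.
Proof. by rewrite -sum1_card big_mkcond; apply: eq_bigr => a _; rewrite unfold_in; case: (P a). Qed.

Lemma card_set_fibers (U : choiceType) (L : finType) (s : seq U) (P : U -> pred L)
    (A : set (U * L)) :
  uniq s -> (forall p, A p <-> p.1 \in s /\ P p.1 p.2) ->
  card_set A = (\sum_(v <- s) #|P v|)%N.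
Proof.
move=> us AP.
rewrite (@card_set_seq _ _ [seq (v, a) | v <- s, a <- enum (P v)]).
- rewrite size_allpairs_dep sumnE big_map; apply: eq_bigr => v _.
  by rewrite -cardE.
- apply: allpairs_uniq_dep => // [v _|[v a] [w b] _ _ /= [-> ->]] //.
  exact: enum_uniq.
- move=> [v a]; rewrite AP /=; split=> [[vs Pva]|/allpairsPdep[w [b [ws + [-> ->]]]]].
    by apply/allpairsPdep; exists v, a; rewrite mem_enum.
  by rewrite mem_enum.
Qed.

Section PrefixForest.
Variable I : finType.
Implicit Types (a : I * bool) (u v w : word I) (V : seq (word I)).

Definition parent w : word I := if w is c :: w' then belast c w' else [::].

Lemma parent_rcons w a : parent (rcons w a) = w.
Proof. by case: w => //= c w; rewrite belast_rcons. Qed.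

(** The tops are the roots of the forest induced on [V]. The empty word is treated apart because its
    [parent] is itself by default. *)
Definition is_top V w : bool := (w == [::]) || (parent w \notin V).

Definition degree V v : nat := #|[pred a | step v a \in V]|.

Lemma rcons_eqE v a u c : (rcons u c == rcons v a) = (u == v) && (c == a).
Proof. exact: eqseq_rcons. Qed.

(** The inverse of the last letter of [v] leads to the parent, the other letters to children;
    appending that inverse would not give a reduced word, so it counts for no child. *)
Lemma degree_parent V v : (forall w, w \in V -> reduced w) ->
  degree V v = (~~ is_top V v + \sum_a (rcons v a \in V : nat))%N.
Proof.
move=> Vred; rewrite /degree card_pred_sum /is_top.
case/lastP: v => [|u c]; first by rewrite eqxx add0n.
rewrite parent_rcons negb_or negbK -size_eq0 size_rcons /=.
rewrite [X in (X + _)%N](_ : _ = \sum_a (a == inv_letter c : nat) * (u \in V))%N.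
  rewrite -big_split; apply: eq_bigr => a _ /=; rewrite step_rcons.
  rewrite eq_sym -(can_eq (@inv_letterK I)) inv_letterK.
  case: eqP => [->|_]; rewrite ?mul0n // mul1n.
  suff /negPf -> : rcons (rcons u c) (inv_letter c) \notin V by rewrite addn0.
  apply/negP => /Vred; rewrite reduced_rcons; case: u => [|d u] /=.
    by rewrite eqxx.
  by rewrite last_rcons eqxx andbF.
rewrite (bigD1 (inv_letter c)) //= eqxx mul1n big1 ?addn0 // => a /negPf ->.
by rewrite mul0n.
Qed.

(* Each vertex whose parent is in V contributes one edge, seen from both ends. *)
Lemma sum_degree V : uniq V -> (forall w, w \in V -> reduced w) ->
  (\sum_(v <- V) degree V v + 2 * count (is_top V) V = 2 * size V)%N.
Proof.
move=> uV Vred; under eq_bigr do rewrite degree_parent //.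
rewrite big_split /=.
(* Counting children over all parents counts each vertex with its parent in [V] exactly once. *)
have -> : (\sum_(v <- V) \sum_a (rcons v a \in V : nat) =
    \sum_(v <- V) (~~ is_top V v : nat))%N.
  have memE w : (w \in V : nat) = (\sum_(u <- V) (u == w : nat))%N.
    have -> : (\sum_(u <- V) (u == w : nat) = count_mem w V)%N.
      by rewrite -sum1_count [RHS]big_mkcond; apply: eq_bigr => u _ /=; case: eqP.
    by rewrite count_uniq_mem.
  under eq_bigr do under eq_bigr do rewrite memE.
  under eq_bigr do rewrite exchange_big.
  rewrite exchange_big; apply: eq_bigr => u _; rewrite /is_top.
  case/lastP: u => [|u c].
    by rewrite eqxx big1 // => v _; rewrite big1 // => a _; case: v.
  rewrite parent_rcons negb_or negbK -size_eq0 size_rcons /= memE.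
  apply: eq_bigr => v _; rewrite eq_sym.
  rewrite (bigD1 c) //= rcons_eqE eqxx andbT big1 ?addn0 // => a ac.
  by rewrite rcons_eqE [c == a]eq_sym (negPf ac) andbF.
have -> : (\sum_(v <- V) (~~ is_top V v : nat) = count (predC (is_top V)) V)%N.
  by rewrite -sum1_count [RHS]big_mkcond; apply: eq_bigr => v _ /=; case: is_top.
by rewrite -(count_predC (is_top V) V); lia.
Qed.

Definition climb V w : word I := if is_top V w then w else parent w.

(** The top of the component of [w]: climbing shortens the word until a top is reached, so [size w]
    iterations suffice, and tops are fixed. *)
Definition top_above V w : word I := iter (size w) (climb V) w.

Lemma top_above_top V w : is_top V w -> top_above V w = w.
Proof. by move=> tw; rewrite /top_above; elim: (size w) => //= k ->; rewrite /climb tw. Qed.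

Lemma top_above_rcons V w a : w \in V -> top_above V (rcons w a) = top_above V w.
Proof.
move=> wV; rewrite /top_above size_rcons iterSr /climb.
by rewrite /is_top parent_rcons wV orbF -size_eq0 size_rcons.
Qed.

End PrefixForest.

(** * Walks and connected components *)

Section Walks.
Variables (V : choiceType) (G : collection V).
Hypothesis graphG : is_graph G.
Implicit Types u v : V.

Lemma walk_cons u v p : walk G u (v :: p) <-> edges G (u, v) /\ walk G v p.
Proof.
by rewrite /walk /=; split=> [/andP[]|[uv vp]]; rewrite ?inE //; apply/andP; rewrite inE.
Qed.

Lemma walk_sym u p : walk G u p ->
  exists2 q, walk G (last u p) q & last (last u p) q = u.
Proof.
move=> up; exists (rev (belast u p)).
  rewrite /walk rev_path; apply: sub_path up => x y.
  by rewrite !inE => /graphG[].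
by case: p {up} => //= x p; rewrite rev_cons last_rcons.
Qed.

Lemma component_of_refl u : component_of G u u.
Proof. by exists [::]. Qed.

Lemma component_of_trans u v w :
  component_of G u v -> component_of G v w -> component_of G u w.
Proof.
move=> [p up <-] [q vq <-]; exists (p ++ q); last by rewrite last_cat.
by rewrite /walk cat_path; apply/andP.
Qed.

Lemma component_of_eq u v : component_of G u v -> component_of G u = component_of G v.
Proof.
move=> uv; have vu : component_of G v u.
  by case: uv => p up <-; have [q] := walk_sym up; exists q.
by apply/seteqP; split=> w; apply: component_of_trans.
Qed.

Lemma edge_component u v : edges G (u, v) -> component_of G u v.
Proof. by move=> uv; exists [:: v] => //; apply/walk_cons. Qed.

Lemma walk_invariant (W : Type) (f : V -> W) u p :
  (forall x y, edges G (x, y) -> f x = f y) -> walk G u p -> f (last u p) = f u.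
Proof.
move=> fG; by elim: p u => // x p IH u /walk_cons[/fG -> /IH].
Qed.

End Walks.

(** * Induced subgraphs of the transversal tree *)

Section TransversalTree.
Variables (n : nat) (T : set (word 'I_n)).
Hypothesis Tred : forall w, T w -> reduced w.
Implicit Types (a : 'I_n * bool) (u v w : word 'I_n).

Let G := transversal_tree T.

(** With [step], parents and children are reached uniformly by letters, so that edges can be counted
    letter by letter. *)
Lemma tree_edgeP u v : edges G (u, v) <-> [/\ T u, T v & exists a, v = step u a].
Proof.
split=> [[/= Tu Tv [a [va|ua]]]|[Tu Tv [a va]]]; split=> //=.
- by exists a; rewrite va step_reduced_rcons // -va; exact: Tred.
- by exists (inv_letter a); rewrite ua step_rcons_inv.
- move: va; case/lastP: u Tu => [|u c] _ va; first by exists a; left.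
  move: va; rewrite step_rcons; case: eqP => _ ->; first by exists c; right.
  by exists a; left.
Qed.

Lemma tree_is_graph : is_graph G.
Proof.
by move=> u v [Tu Tv [a [va|ua]]]; split=> //; split=> //=; exists a; [right|left].
Qed.

Section Subgraph.
Variable K : collection (word 'I_n).
Hypothesis KG : induced_subgraph K G.
Hypothesis Kfin : finite_set (verts K).

Let V : seq (word 'I_n) := fset_set (verts K).

Lemma subgraph_is_graph : is_graph K. Proof. by case: KG => -[]. Qed.

Lemma subgraph_verts v : v \in V <-> verts K v.
Proof. by rewrite /V in_fset_set // inE. Qed.

Lemma subgraph_verts_in v : verts K v -> T v.
Proof. by case: KG => -[_ + _] _; apply. Qed.

Lemma subgraph_edgeP u v :
  edges K (u, v) <-> [/\ verts K u, verts K v & exists a, v = step u a].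
Proof.
split=> [uv|[Ku Kv [a va]]].
  have [Ku Kv _] := subgraph_is_graph uv; split=> //.
  by case: KG => -[_ _ /(_ _ uv)/tree_edgeP[]].
case: KG => _; apply=> //; apply/tree_edgeP; split; try exact: subgraph_verts_in.
by exists a.
Qed.

Lemma top_above_in_component v : verts K v ->
  [/\ verts K (top_above V v), is_top V (top_above V v) & component_of K v (top_above V v)].
Proof.
elim/last_ind: v => [|v a IH] Kv.
  by rewrite top_above_top ?/is_top ?eqxx //; split=> //; exact: component_of_refl.
have [vV|vV] := boolP (v \in V); last first.
  have tv : is_top V (rcons v a) by rewrite /is_top parent_rcons vV orbT.
  by rewrite top_above_top //; split=> //; exact: component_of_refl.
have Kv' := (subgraph_verts v).1 vV.
rewrite top_above_rcons //; have [Kr tr vr] := IH Kv'; split=> //.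
apply: component_of_trans vr; apply: edge_component; apply/subgraph_edgeP; split=> //.
by exists (inv_letter a); rewrite step_rcons_inv.
Qed.

Lemma top_above_walk u p : walk K u p -> top_above V (last u p) = top_above V u.
Proof.
apply: walk_invariant => x y xy; have [Kx Ky _] := (subgraph_edgeP x y).1 xy.
have [_ _ [a [/= yx|/= xy']]] : edges G (x, y) by case: KG => -[_ _ /(_ _ xy)].
  by rewrite yx top_above_rcons //; exact/subgraph_verts.
by rewrite xy' top_above_rcons //; exact/subgraph_verts.
Qed.

(** Every component contains a top, found by climbing, and only one, since [top_above] is constant
    along walks. *)
Lemma num_components_top : num_components K = count (is_top V) V.
Proof.
rewrite -size_filter /num_components.
rewrite (@card_set_seq _ _ [seq component_of K u | u <- V & is_top V u]).
- by rewrite size_map.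
- rewrite map_inj_in_uniq ?filter_uniq ?fset_uniq // => u v.
  rewrite !mem_filter => /andP[tu _] /andP[tv _] uv.
  have [p up pv] : component_of K u v by rewrite uv; exact: component_of_refl.
  by have := top_above_walk up; rewrite pv !top_above_top.
- move=> C; split=> [[u /= Ku <-]|/mapP[u]].
    have [Kr tr ur] := top_above_in_component Ku.
    rewrite (component_of_eq subgraph_is_graph ur); apply: map_f.
    by rewrite mem_filter tr; exact/subgraph_verts.
  by rewrite mem_filter => /andP[_ /subgraph_verts Ku] ->; exists u.
Qed.

(** Boolean form of the boundary condition, in terms of letters, for use in counts. *)
Definition on_boundary v : bool :=
  [exists a, (step v a \in T) && (step v a \notin V)].

Lemma boundaryP v : verts (graph_boundary G K) v <-> v \in V /\ on_boundary v.
Proof.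
rewrite /graph_boundary /=; split.
  move=> [Kv [[_ //]|[w wv]]]; split; first exact/subgraph_verts.
  (* The span may provide the missing edge in either direction. As [K] is induced, its other end [w]
     must then lie outside [K]. *)
  have [vw nvw] : edges G (v, w) /\ ~ edges K (v, w).
    case: wv => -[/= e ne]; first by [].
    have [_ _ e'] := tree_is_graph e; split=> // e''; apply: ne.
    by have [] := subgraph_is_graph e''.
  have [Tv Tw [a wE]] := (tree_edgeP v w).1 vw.
  apply/existsP; exists a; rewrite -wE mem_set //=.
  apply/negP => /subgraph_verts Kw; apply: nvw; apply/subgraph_edgeP; split=> //.
  by exists a.
move=> [/subgraph_verts Kv /existsP[a /andP[/set_mem Ta na]]].
split=> //; right; exists (step v a); left; split=> /=.
  apply/tree_edgeP; split=> //; [exact: subgraph_verts_in|by exists a].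
by move/subgraph_edgeP => [_ /subgraph_verts]; rewrite (negPf na).
Qed.

Lemma interiorP v : verts (graph_interior G K) v <-> v \in V /\ ~~ on_boundary v.
Proof.
rewrite /graph_interior; split=> [[/= Kv nB]|[vV nb]].
  split; first exact/subgraph_verts.
  by apply/negP => bv; apply: nB; apply/boundaryP; split=> //; exact/subgraph_verts.
split=> [|/boundaryP[_]]; first exact/subgraph_verts.
by rewrite (negPf nb).
Qed.

Lemma card_boundary : card_set (verts (graph_boundary G K)) = count on_boundary V.
Proof.
rewrite -size_filter (@card_set_seq _ _ [seq v <- V | on_boundary v]) //.
  by rewrite filter_uniq // fset_uniq.
by move=> v; rewrite boundaryP mem_filter; split=> [[-> ->]|/andP[]].
Qed.

Lemma card_interior :
  card_set (verts (graph_interior G K)) = count (predC on_boundary) V.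
Proof.
rewrite -size_filter (@card_set_seq _ _ [seq v <- V | predC on_boundary v]) //.
  by rewrite filter_uniq // fset_uniq.
by move=> v; rewrite interiorP mem_filter /=; split=> [[-> ->]|/andP[]].
Qed.

(** The tree has no loops, so any neighbour is a second vertex of the component. *)
Lemma degree_eq0P v : verts K v -> degree V v = 0%N <-> component_of K v = [set v].
Proof.
move=> Kv; split=> [/eqP d0|cv].
  apply/seteqP; split=> [w [[|x p] //]|_ ->]; last exact: component_of_refl.
  move=> /walk_cons[/subgraph_edgeP[_ Kx [a xE]] _] _.
  move: d0; rewrite /degree => /eqP/card0_eq/(_ a).
  by rewrite inE -xE => /negP; case; exact/subgraph_verts.
apply: eq_card0 => a; rewrite inE; apply/negP => /subgraph_verts Ka.
have : component_of K v (step v a).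
  by apply/edge_component/subgraph_edgeP; split=> //; exists a.
by rewrite cv => /step_neq.
Qed.

Lemma card_trivial_components :
  card_set [set C | components K C /\ exists v, C = [set v]] =
  count (fun v => degree V v == 0) V.
Proof.
rewrite -size_filter.
rewrite (@card_set_seq _ _ [seq [set v] | v <- V & degree V v == 0%N]).
- by rewrite size_map.
- rewrite map_inj_uniq ?filter_uniq ?fset_uniq // => u v uv.
  by have : [set u] u by []; rewrite uv.
- move=> C; split=> [[[u /= Ku <-] [v cv]]|/mapP[v]].
    have uv : u = v by have := component_of_refl K u; rewrite cv.
    rewrite cv -uv; apply: map_f; rewrite mem_filter; apply/andP; split.
      by apply/eqP/degree_eq0P => //; rewrite cv uv.
    exact/subgraph_verts.
  rewrite mem_filter => /andP[/eqP d0 /subgraph_verts Kv] ->.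
  split; last by exists v.
  by exists v => //; exact/degree_eq0P.
Qed.

End Subgraph.
End TransversalTree.

(** * Ball decompositions *)

Lemma prefix_rconsE (I : eqType) (x c : seq I) (b : I) :
  prefix x (rcons c b) = (x == rcons c b) || prefix x c.
Proof.
apply/idP/orP => [/prefixP[s]|[/eqP ->|]]; last first.
- by move/prefix_trans; apply; exact: prefix_rcons.
- exact: prefix_refl.
case/lastP: s => [|s e]; first by rewrite cats0 => ->; left.
by rewrite -rcons_cat => /rcons_inj[-> _]; right; exact: prefix_prefix.
Qed.

(** The only edge between the subtree rooted at [x] and the rest of the tree joins [x] to its
    parent. *)
Lemma prefix_rcons_differ (I : eqType) (x c : seq I) (b : I) :
  prefix x c != prefix x (rcons c b) -> x = rcons c b.
Proof. by rewrite prefix_rconsE; case: (x =P _) => //; rewrite eqxx. Qed.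

(** * Neighbours of a vertex within a ball *)

Section BallBoundary.
Variables (n : nat) (T : set (word 'I_n)).
Hypothesis Tred : forall w, T w -> reduced w.
Implicit Types (a : 'I_n * bool) (u v w c : word 'I_n).

Let G := transversal_tree T.

(* The subtree rooted at x = rcons v a is attached to the rest of the tree by
   the edge joining x to v, so a walk entering or leaving it goes through v. *)
Lemma walk_through_parent v a c p :
  walk G c p -> prefix (rcons v a) c != prefix (rcons v a) (last c p) ->
  last c p <> v ->
  exists2 r, walk G c r & last c r = v /\ (size r < size p)%N.
Proof.
elim: p c => [|d p IH] c; first by rewrite eqxx.
move=> /walk_cons[cd dp] /= differ lv.
have [->|cv] := eqVneq c v; first by exists [::].
have [dv|dv] := eqVneq d v.
  exists [:: d]; first exact/walk_cons.
  by split=> //; case: p dp lv {IH differ} => [|e p] _ //=; rewrite dv.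
have [same|] := eqVneq (prefix (rcons v a) c) (prefix (rcons v a) d).
  rewrite same in differ; have [r dr [rv rp]] := IH d dp differ lv.
  by exists (d :: r); [exact/walk_cons|].
case: cd => [_ _ [b [/= dE|/= cE]]].
  by rewrite dE => /prefix_rcons_differ/rcons_inj[/esym/eqP]; rewrite (negPf cv).
by rewrite cE eq_sym => /prefix_rcons_differ/rcons_inj[/esym/eqP]; rewrite (negPf dv).
Qed.

(* If the centre c reached neither of two neighbours of v through v, the tree
   would contain a cycle; so v is closer to c than one of them. *)
Lemma ball_two_neighbours c k v a a' b : T v -> a != a' ->
  T (step v b) ->
  verts (graph_ball G c k) (step v a) -> verts (graph_ball G c k) (step v a') ->
  verts (graph_ball G c k) (step v b).
Proof.
(* At most one of the two letters leads to the parent of [v], so [a] may be assumed to lead to a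
   child. *)
move=> Tv; wlog rv : a a' / step v a = rcons v a => [thm aa' Tb Ba Ba'|].
  have [ra|na] := eqVneq (step v a) (rcons v a); first exact: (thm a a').
  apply: (thm a' a) => //; last by rewrite eq_sym.
  move: na; case/lastP: v Tv {thm Tb Ba Ba'} => [|u d] Tv //.
  rewrite !step_rcons; case: (d =P inv_letter a) => [->|_]; last by rewrite eqxx.
  by rewrite (inj_eq (can_inj (@inv_letterK _))) (negPf aa').
move=> aa' Tb [Ta [p [cp pa pk]]] [_ [q [cq qa qk]]].
(* If [v] is at distance less than [k] from the centre, all its neighbours are in the ball. *)
suff [r cr [rv' rk]] : exists2 r, walk G c r & last c r = v /\ (size r < k)%N.
  split=> //; exists (rcons r (step v b)); split; last by rewrite size_rcons.
    rewrite /walk rcons_path; apply/andP; split=> //.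
    by rewrite rv'; apply: mem_set; apply/(tree_edgeP Tred); split=> //; exists b.
  by rewrite last_rcons.
(* If the centre is in the subtree of the child [rcons v a], the walk to [step v a'] leaves that
   subtree through [v]; if not, the walk to [step v a] enters it through [v]. *)
have [xc|xc] := boolP (prefix (rcons v a) c).
  have [||r cr [rv' rq]] := walk_through_parent (v := v) (a := a) cq.
  - rewrite xc qa; case: (boolP (prefix _ (step v a'))) => // pr.
    have [va|] : step v a' = rcons v a' \/ (size (step v a') < size v)%N.
        case/lastP: (v) => [|u d]; first by left.
        rewrite step_rcons size_rcons; case: eqP => _; first by right.
        by left.
      move: pr; rewrite va prefixE size_rcons -(size_rcons v a') take_size.
      by rewrite eqseq_rcons eqxx eq_sym (negPf aa').
    by move: (size_prefix pr); rewrite size_rcons => le lt; have := ltn_trans lt le; rewrite ltnn.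
  - by rewrite qa; exact: step_neq.
  - by exists r => //; split=> //; exact: leq_trans qk.
have [||r cr [rv' rq]] := walk_through_parent (v := v) (a := a) cp.
- by rewrite (negPf xc) pa rv prefix_refl.
- by rewrite pa; exact: step_neq.
- by exists r => //; split=> //; exact: leq_trans pk.
Qed.
End BallBoundary.

(** * Counting letters at the vertices of a union of balls *)

Section BallDecomposition.
Variables (n : nat) (T : set (word 'I_n)).
Hypothesis Tred : forall w, T w -> reduced w.
Hypothesis Tcat : forall u v, T (u ++ v) -> T u.
Implicit Types (a : 'I_n * bool) (u v w : word 'I_n).

Let G := transversal_tree T.

Lemma tree_rcons w a : T (rcons w a) -> T w.
Proof. by rewrite -cats1; exact: Tcat. Qed.

Lemma card_letters (V : seq (word 'I_n)) v : (forall w, w \in V -> T w) ->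
  (2 * n = #|[pred a | step v a \notin T]| + degree V v +
    #|[pred a | (step v a \in T) && (step v a \notin V)]|)%N.
Proof.
move=> VT; rewrite /degree !card_pred_sum -!big_split /= (eq_bigr (fun=> 1%N)).
  by rewrite sum1_card card_prod card_ord card_bool mulnC.
move=> a _; have [vV|] := boolP (step v a \in V); last by case: (_ \in T).
by rewrite mem_set //; exact: VT.
Qed.

Section Subgraph.
Variable K : collection (word 'I_n).
Hypothesis KG : induced_subgraph K G.
Hypothesis Kfin : finite_set (verts K).
Hypothesis Kballs : forall C, components K C ->
  exists c k, verts G c /\ induced_on K C = graph_ball G c k.

Let V : seq (word 'I_n) := fset_set (verts K).

(** Two neighbours in [K] lie in the same ball as [v]; that ball would then contain every neighbour
    of [v] in the tree, and [v] would not be on the boundary. *)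
Lemma boundary_degree v : v \in V -> on_boundary T K v -> (degree V v <= 1)%N.
Proof.
move=> /(subgraph_verts Kfin) Kv /existsP[b /andP[/set_mem Tb nb]].
have Tv := subgraph_verts_in KG Kv.
rewrite leqNgt; apply/negP => /card_gt1P[a [a' []]]; rewrite !inE => aV a'V aa'.
have [c [k [_ CE]]] : exists c k, verts G c /\
    induced_on K (component_of K v) = graph_ball G c k.
  by apply: Kballs; exists v.
have inball d : step v d \in V -> verts (graph_ball G c k) (step v d).
  move/(subgraph_verts Kfin) => Kd; rewrite -CE; split=> //.
  by apply/edge_component/(subgraph_edgeP Tred KG); split=> //; exists d.
have := ball_two_neighbours Tred Tv aa' Tb (inball a aV) (inball a' a'V).
by rewrite -/G -CE => -[/(subgraph_verts Kfin)]; rewrite (negPf nb).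
Qed.

(** In a tree with at least two vertices every vertex has a neighbour, so an isolated vertex of [K]
    is on the boundary. In a one-vertex tree both sides are 0, the left one by convention. *)
Lemma num_trivial_components_boundary : num_trivial_components G K =
  count (fun v => on_boundary T K v && (degree V v == 0%N)) V.
Proof.
rewrite /num_trivial_components; case: asboolP => [[x [y [Tx Ty xy]]]|T1].
  rewrite (card_trivial_components Tred KG Kfin); apply: eq_in_count => v vV.
  have [d0|] := eqVneq (degree V v) 0%N; last by rewrite andbF.
  rewrite andbT; apply/esym/existsP.
  have Tv : T v by exact/(subgraph_verts_in KG)/(subgraph_verts Kfin).
  suff [a Ta] : exists a, T (step v a).
    exists a; rewrite mem_set //=; apply/negP => aV.
    by have := card0_eq d0 a; rewrite inE aV.
  (* A neighbour of [v] is its parent or, at the root, the first letter of any nonempty word of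
     [T]. *)
  case/lastP: v Tv {vV d0} => [_|u a /tree_rcons Tu]; last first.
    by exists (inv_letter a); rewrite step_rcons_inv.
  have [z Tz] : exists2 z, T z & z != [::].
    by case: (eqVneq x [::]) xy => [->|nx _]; [exists y; rewrite // eq_sym|exists x].
  by case: z Tz => // a z Tz _; exists a; exact: (@Tcat [:: a] z).
apply/esym/eqP; rewrite eqn0Ngt -has_count; apply/hasPn => v vV.
apply/negP => /andP[/existsP[a /andP[/set_mem Ta _]] _]; case: T1.
exists (step v a), v; split=> //; first exact/(subgraph_verts_in KG)/(subgraph_verts Kfin).
exact/eqP/step_neq.
Qed.

Definition interior_ends : set (word 'I_n * ('I_n * bool)) :=
  [set p | verts (graph_interior G K) p.1 /\ tree_ends T p].

Lemma card_interior_ends : card_set interior_ends =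
  (\sum_(v <- V | ~~ on_boundary T K v) #|[pred a | step v a \notin T]|)%N.
Proof.
rewrite -big_filter; apply: card_set_fibers => [|[v a]].
  by rewrite filter_uniq // fset_uniq.
rewrite /= mem_filter notin_setE; split.
  by move=> [/(interiorP Tred KG Kfin)[vV ->] [_ Ta]].
move=> [/andP[nb vV] Ta]; split; first exact/(interiorP Tred KG Kfin).
by split=> //; exact/(subgraph_verts_in KG)/(subgraph_verts Kfin).
Qed.

(** Twice the first expression of the theorem equals the number of interior ends, with the negative
    terms moved across to stay in the natural numbers. *)
Lemma ball_decomposition_count :
  (2 * n * card_set (verts K) + 2 * num_components K +
     card_set (verts (graph_boundary G K)) =
   card_set interior_ends + 2 * n * card_set (verts (graph_boundary G K)) +
     num_trivial_components G K + 2 * card_set (verts K))%N.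
Proof.
rewrite num_trivial_components_boundary card_interior_ends.
rewrite (num_components_top Tred KG Kfin) (card_boundary Tred KG Kfin) -/V.
have VT w : w \in V -> T w.
  by move/(subgraph_verts Kfin)/(subgraph_verts_in KG).
rewrite -[card_set (verts K)]/(size V).
have := sum_degree (fset_uniq _) (fun w wV => Tred (VT w wV)); rewrite -/V.
(* The degree sum [d] eliminates the number [e] of components; what remains can be checked vertex by
   vertex. *)
have arith (p q a b c d e s : nat) : (p + b = a + q + c + d -> d + 2 * e = 2 * s ->
    p + 2 * e + b = a + q + c + 2 * s)%N by lia.
apply: arith.
have countE (P : pred (word 'I_n)) : count P V = (\sum_(v <- V) (P v : nat))%N.
  by rewrite -sum1_count big_mkcond; apply: eq_bigr => v _; case: (P v).
have -> : (size V = \sum_(v <- V) 1)%N by rewrite sum1_size.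
rewrite !countE [X in (_ = X + _ + _ + _)%N]big_mkcond !big_distrr -!big_split.
rewrite big_seq [RHS]big_seq; apply: eq_bigr => v vV /=.
have := card_letters v VT; have := boundary_degree vV.
(* At a boundary vertex the degree plus the indicator of degree 0 is 1. At an interior vertex no
   letter leads into [T] outside [V]. *)
have [_ /(_ isT)|/existsPn nb _] := boolP (on_boundary T K v) => /=.
  by case: (degree V v) => [|[|d]] //= _ _; lia.
rewrite [X in (_ + X)%N]eq_card0; first lia.
by move=> a; rewrite inE; exact/negbTE/nb.
Qed.

Local Open Scope ring_scope.

Lemma ball_decomposition_rank (R : realFieldType) :
  (num_components K)%:R - 2^-1 * (num_trivial_components G K)%:R
    + (n%:R - 1) * (card_set (verts K))%:R
    - (2 * n%:R - 1) / 2 * (card_set (verts (graph_boundary G K)))%:R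
  = 2^-1 * (card_set interior_ends)%:R :> R.
Proof.
have := congr1 (fun m : nat => m%:R : R) ball_decomposition_count.
rewrite !natrD !natrM; lra.
Qed.

Lemma card_interior_boundary : card_set (verts K) =
  (card_set (verts (graph_interior G K)) + card_set (verts (graph_boundary G K)))%N.
Proof.
rewrite (card_interior Tred KG Kfin) (card_boundary Tred KG Kfin) addnC.
by rewrite count_predC.
Qed.

End Subgraph.

(** * Balls centred at the root *)

Section Ball.
Variable i : nat.
Hypothesis Tnil : T [::].

Let B : set (word 'I_n) := [set w | T w /\ (size w <= i)%N].
Let V : seq (word 'I_n) := fset_set B.

(** Ends at all vertices of the ball, the outermost sphere included; the edges leaving the ball
    within the tree are counted exactly, by the next sphere. *)
Definition ball_ends : set (word 'I_n * ('I_n * bool)) :=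
  [set p | (size p.1 <= i)%N /\ tree_ends T p].

Lemma finite_words k : finite_set [set w : word 'I_n | (size w <= k)%N].
Proof.
elim: k => [|k IH].
  apply: (@sub_finite_set _ _ [set [::]]); last exact: finite_set1.
  by case.
apply: (@sub_finite_set _ _ ([set [::]] `|`
  (fun p => p.1 :: p.2) @` ([set: 'I_n * bool] `*` [set w | (size w <= k)%N]))).
  by case=> [|a w] /= wk; [left|right; exists (a, w)].
rewrite finite_setU; split; first exact: finite_set1.
by apply/finite_image/finite_setX => //; exact: finite_finset.
Qed.

Let memV w : w \in V <-> T w /\ (size w <= i)%N.
Proof.
rewrite /V in_fset_set ?inE //; apply: sub_finite_set (finite_words i).
by move=> w' [].
Qed.

Lemma finite_ball_ends : finite_set ball_ends.
Proof.
apply: (@sub_finite_set _ _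
  ([set w : word 'I_n | (size w <= i)%N] `*` [set: 'I_n * bool])).
  by move=> [v a] [].
by apply: finite_setX; [exact: finite_words|exact: finite_finset].
Qed.

Lemma card_ball_ends :
  card_set ball_ends = (\sum_(v <- V) #|[pred a | step v a \notin T]|)%N.
Proof.
apply: card_set_fibers => [|[v a]]; first exact: fset_uniq.
rewrite /= memV notin_setE; split; first by move=> [? []].
by move=> [[? ?] ?].
Qed.

(** Only a step that lengthens a word of maximal length [i] can leave the ball. *)
Lemma outer_step v a : v \in V -> T (step v a) -> step v a \notin V ->
  step v a = rcons v a /\ size v = i.
Proof.
move=> /memV[Tv vi] Ta nV; have ai : (i < size (step v a))%N.
  by rewrite ltnNge; apply/negP => ai; case/negP: nV; exact/memV.
move: ai vi; case/lastP: v {Tv Ta nV} => [|u c] /=; first by split=> //; lia.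
rewrite step_rcons; case: eqP => _; rewrite !size_rcons; first lia.
by split=> //; lia.
Qed.

Lemma sphere_growth_outer : sphere_growth T i.+1 =
  (\sum_(v <- V) #|[pred a | (step v a \in T) && (step v a \notin V)]|)%N.
Proof.
pose out v := [pred a | (step v a \in T) && (step v a \notin V)].
rewrite /sphere_growth (@card_set_seq _ _ [seq rcons v a | v <- V, a <- enum (out v)]).
- rewrite size_allpairs_dep sumnE big_map; apply: eq_bigr => v _.
  by rewrite -cardE.
- apply: allpairs_uniq_dep => [|v _|[v a] [w b] _ _ /= /rcons_inj[-> ->]] //.
  + exact: fset_uniq.
  + exact: enum_uniq.
- move=> x; split=> [|/allpairsPdep[w [b [wV + ->]]]]; last first.
    rewrite mem_enum inE => /andP[/set_mem Tb nb].
    have [sE wi] := outer_step wV Tb nb.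
    by split; [rewrite -sE|rewrite size_rcons wi].
  case/lastP: x => [[//]|v a [Ta]]; rewrite size_rcons => -[vi].
  apply/allpairsPdep; exists v, a; have sE := step_reduced_rcons (Tred Ta).
  split=> //; first by apply/memV; split; [exact: tree_rcons Ta|rewrite vi].
  rewrite mem_enum inE sE mem_set //=; apply/negP => /memV[_].
  by rewrite size_rcons vi ltnn.
Qed.

Lemma ball_growth_count :
  (2 * n * ball_growth T i + 2 =
   card_set ball_ends + sphere_growth T i.+1 + 2 * ball_growth T i)%N.
Proof.
rewrite card_ball_ends sphere_growth_outer -[ball_growth T i]/(size V).
have VT w : w \in V -> T w by move/memV => [].
have := sum_degree (fset_uniq _) (fun w wV => Tred (VT w wV)); rewrite -/V.
(* The ball is connected: its only top is the root. This is the source of the constant 1 in the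
   formula. *)
have -> : count (is_top V) V = 1%N.
  rewrite (eq_in_count (a2 := pred1 [::])).
    by rewrite count_uniq_mem ?fset_uniq //; case: (boolP (_ \in V)) => // /negP[]; apply/memV.
  move=> v; case/lastP: v => [|u a]; first by rewrite /is_top eqxx.
  move=> /memV[Tu]; rewrite size_rcons => ui.
  rewrite /is_top parent_rcons (_ : u \in V) ?orbF //.
  by apply/memV; split; [exact: tree_rcons Tu|exact: ltnW].
have arith (p a d o s : nat) : (p = a + d + o -> d + 2 * 1 = 2 * s ->
    p + 2 = a + o + 2 * s)%N by lia.
apply: arith.
rewrite -!big_split /= (eq_bigr (fun=> (2 * n)%N)); last first.
  by move=> v _; rewrite -card_letters.
by rewrite big_const_seq count_predT iter_addn_0 mulnC.
Qed.

Local Open Scope ring_scope.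

Lemma ball_growth_rank (R : realFieldType) :
  (n%:R - 1) * (ball_growth T i)%:R - 2^-1 * (sphere_growth T i.+1)%:R =
  2^-1 * (card_set ball_ends)%:R - 1 :> R.
Proof.
have := congr1 (fun m : nat => m%:R : R) ball_growth_count.
rewrite !natrD !natrM; lra.
Qed.

End Ball.
End BallDecomposition.

Local Open Scope ring_scope.

(** * Passage to the limit *)

Section Rank.
Variables (R : realType) (F : groupType) (n : nat) (X : 'I_n -> F).
Hypothesis freeX : free_basis X setT.
Variable H : set F.
Hypothesis subgroupH : group_closed (mem H).
Variable T : set (word 'I_n).
Hypothesis transT : schreier_transversal X H T.

Let Tred w : T w -> reduced w. Proof. exact: transversal_reduced transT w. Qed.
Let Tcat u v : T (u ++ v) -> T u. Proof. by case: transT => _ _ + _; apply. Qed.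

Lemma cvg_half_card_ends (D : nat -> set (word 'I_n * ('I_n * bool))) :
  (\forall i \near \oo, finite_set (D i) /\ D i `<=` tree_ends T) ->
  (forall p, tree_ends T p -> \forall i \near \oo, D i p) ->
  (2^-1 * (card_set (D i))%:R : R)%:E @[i --> \oo] --> group_rank R H.
Proof.
move=> fD DE; rewrite (group_rank_ends freeX subgroupH transT).
under eq_fun do rewrite EFinM.
by apply: cvgeZl => //; exact: cvg_card_counting.
Qed.

(** Half the number of ends in the ball of radius [i] tends to the rank, and [u i] is this number
    minus 1; the finite constant can be moved across the limit even when the rank is infinite. *)
Lemma ball_growth_cvg (u := fun i : nat =>
    ((n%:R - 1) * (ball_growth T i)%:R - 2^-1 * (sphere_growth T i.+1)%:R : R)%:E) :
  cvgn u /\ group_rank R H = (1 + limn u)%E.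
Proof.
have half : (2^-1 * (card_set (ball_ends T i))%:R : R)%:E @[i --> \oo] --> group_rank R H.
  apply: cvg_half_card_ends => [|p Tp].
    by near=> i; split; [exact: finite_ball_ends|move=> p []].
  by near=> i; split=> //; near: i; exact: nbhs_infty_ge.
have uE : u = (fun i => (2^-1 * (card_set (ball_ends T i))%:R : R)%:E - 1)%E.
  apply/funext => i; rewrite /u -EFinB; congr (_%:E).
  by apply: ball_growth_rank => //; exact: transversal_nil transT.
have ucvg : u i @[i --> \oo] --> (group_rank R H - 1)%E.
  by rewrite uE; apply: cvgeB => //; [exact: fin_num_adde_defl|exact: cvg_cst].
split; first by apply/cvg_ex; exists (group_rank R H - 1)%E.
by rewrite (cvg_lim _ ucvg) // addeC subeK.
Unshelve. all: by end_near. Qed.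

Section Sequence.
Variable K : nat -> collection (word 'I_n).
Hypothesis Kballs : forall i, (1 <= i)%N ->
  [/\ induced_subgraph (K i) (transversal_tree T), finite_set (verts (K i))
    & forall C, components (K i) C -> exists c k,
        verts (transversal_tree T) c /\
        induced_on (K i) C = graph_ball (transversal_tree T) c k].
Hypothesis Klim : transversal_tree T = graph_liminf K.

Lemma near_verts v : T v -> \forall i \near \oo, verts (K i) v.
Proof.
rewrite -[T]/(verts (transversal_tree T)) Klim => -[i _ Ki].
by near=> j; apply: Ki => /=; near: j; exact: nbhs_infty_ge.
Unshelve. all: by end_near. Qed.

(** The vertex [v] and its finitely many neighbours in the tree all belong to [K i] for large
    [i]. *)
Lemma near_interior v : T v ->
  \forall i \near \oo, verts (graph_interior (transversal_tree T) (K i)) v.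
Proof.
move=> Tv; pose s := v :: [seq step v a | a <- enum [pred a | step v a \in T]].
have sT w : w \in s -> T w.
  rewrite inE => /predU1P[->//|/mapP[a]]; rewrite mem_enum !inE => Ta ->.
  exact: Ta.
have := near_all_mem (fun w ws => near_verts (sT w ws)).
have := nbhs_infty_ge 1; apply: filterS2 => i /Kballs[KG Kfin _] sK.
apply/(interiorP Tred KG Kfin); split.
  by apply/(subgraph_verts Kfin)/sK; rewrite mem_head.
apply/existsPn => a; rewrite negb_and negbK -implybE; apply/implyP => Ta.
apply/(subgraph_verts Kfin)/sK; rewrite inE; apply/orP; right.
by apply: map_f; rewrite mem_enum.
Qed.

Lemma cvg_interior_ends :
  (2^-1 * (card_set (interior_ends T (K i)))%:R : R)%:E @[i --> \oo] --> group_rank R H.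
Proof.
apply: cvg_half_card_ends => [|[v a] [Tv Ta]].
  have := nbhs_infty_ge 1; apply: filterS => i /Kballs[KG Kfin _].
  split; last by move=> p [].
  apply: (@sub_finite_set _ _ (verts (K i) `*` [set: 'I_n * bool])).
    by move=> [v a] [[Kv _] _].
  by apply: finite_setX => //; exact: finite_finset.
by have := near_interior Tv; apply: filterS => i Kv; split.
Qed.

Lemma near_ball_decomposition : \forall i \near \oo,
  2^-1 * (card_set (interior_ends T (K i)))%:R =
  (num_components (K i))%:R - 2^-1 * (num_trivial_components (transversal_tree T) (K i))%:R
    + (n%:R - 1) * (card_set (verts (K i)))%:R
    - (2 * n%:R - 1) / 2
      * (card_set (verts (graph_boundary (transversal_tree T) (K i))))%:R :> R.
Proof.
have := nbhs_infty_ge 1; apply: filterS => i /Kballs[KG Kfin Kb].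
by rewrite (ball_decomposition_rank Tred Tcat KG Kfin Kb).
Qed.

End Sequence.
End Rank.

(** Contrapositively, a subgroup that is not finitely generated has only infinite free bases. *)
Lemma finite_basis_generated (F : groupType) (B H : set F) :
  group_closed (mem H) -> free_basis (fun x : B => val x) H -> finite_set B ->
  finitely_generated H.
Proof.
move=> subgroupH BH fB; exists B => //; apply/seteqP; split=> [h|h]; last first.
  apply; split=> // x Bx; have xB : x \in B by rewrite inE.
  have := free_basis_val [:: (exist _ x xB : B, false)] BH.
  by rewrite word_val1.
case: (BH) => -> _ [w _ <-] L [Lsub BL].
elim: w => [|[x s] w IH]; first by rewrite word_val_nil; exact: subgroup1.
rewrite word_val_cons; apply: subgroupM => //.
have Lx : L (val x) by apply: BL; have := valP x; rewrite inE.
by case: s; rewrite /letter_val //=; exact: subgroupV.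
Qed.

Theorem corollary2p2 (R : realType) (F : groupType) (n : nat) (X : 'I_n -> F)
    (freeX : free_basis X setT)
    (H : set F) (subgroupH : group_closed (mem H))
    (T : set (word 'I_n)) (transT : schreier_transversal X H T) :
  [/\ forall K : nat -> collection (word 'I_n),
        (forall i, (1 <= i)%N ->
           [/\ induced_subgraph (K i) (transversal_tree T),
               finite_set (verts (K i))
             & forall C, components (K i) C ->
                 exists c k, verts (transversal_tree T) c /\
                             induced_on (K i) C = graph_ball (transversal_tree T) c k]) ->
        transversal_tree T = graph_liminf K ->
        ((((num_components (K i))%:R - 2^-1 * (num_trivial_components (transversal_tree T) (K i))%:R
           + (n%:R - 1) * (card_set (verts (K i)))%:R
           - (2 * n%:R - 1) / 2
             * (card_set (verts (graph_boundary (transversal_tree T) (K i))))%:R : R)%:E)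
           @[i --> \oo] --> group_rank R H) /\
        ((((num_components (K i))%:R - 2^-1 * (num_trivial_components (transversal_tree T) (K i))%:R
           + (n%:R - 1) * (card_set (verts (graph_interior (transversal_tree T) (K i))))%:R
           - 2^-1 * (card_set (verts (graph_boundary (transversal_tree T) (K i))))%:R : R)%:E)
           @[i --> \oo] --> group_rank R H),
      let u i : \bar R :=
        ((n%:R - 1) * (ball_growth T i)%:R
         - 2^-1 * (sphere_growth T i.+1)%:R)%:E in
      cvgn u /\ group_rank R H = (1 + limn u)%E,
      let u i : \bar R :=
        ((n%:R - 1) * (cogrowth X H i)%:R
         - 2^-1 * (cosphere_growth X H i.+1)%:R)%:E in
      cvgn u /\ group_rank R H = (1 + limn u)%E
    & ~ finitely_generated H -> group_rank R H = +oo%E ].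
Proof.
split=> [K Kballs Klim| | |infH].
- have half := cvg_interior_ends (R := R) freeX subgroupH transT Kballs Klim.
  have eq1 := near_ball_decomposition R transT Kballs.
  split; apply: cvg_trans half; apply: near_eq_cvg.
    by apply: filterS eq1 => i ->.
  (* Splitting the vertices into interior and boundary turns one expression into the other, since (n
     - 1) - (2n - 1)/2 = -1/2. *)
  have := nbhs_infty_ge 1; apply: filterS2 eq1 => i -> /Kballs[KG Kfin _].
  have -> := card_interior_boundary (fun w => transversal_reduced transT (w := w)) KG Kfin.
  by congr (_%:E); rewrite natrD; lra.
- exact: (@ball_growth_cvg R F n X freeX H subgroupH T transT).
- have [T0 minT0] := minimal_transversal_exists freeX subgroupH.
  (* The transversal chosen in [cogrowth] is then a genuine Schreier transversal, so the formula for
     arbitrary transversals applies to it. *)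
  have := xgetPex set0 (P := [set T' | minimal_schreier_transversal X H T'])
    (ex_intro _ T0 minT0).
  by case=> transT' _; exact: (@ball_growth_cvg R F n X freeX H subgroupH _ transT').
rewrite (group_rank_free_basis _ (schreier_free_basis freeX subgroupH transT)).
rewrite /counting; case: asboolP => // fB; case: infH.
exact: finite_basis_generated (schreier_free_basis freeX subgroupH transT) fB.
Qed.
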